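(* Let $\{G_n\}_{n\in\mathbb{N}}$ be any family of compact connected Hausdorff topological groups such that each $G_n$ has weight at most $2^{\aleph_0}$. Then there exists a type-absolutely connected group $G$, equipped with some first-order structure expanding the group structure, such that for a monster model $G^*$ of $G$ the group $\prod_{n\in\mathbb{N}}G_n/\bigoplus_{n\in\mathbb{N}}G_n$ is a homomorphic image of ${G^*}^{00}_{\emptyset}/{G^*}^{\infty}_{\emptyset}$. If infinitely many of the $G_n$ are non-abelian, then ${G^*}^{00}_{\emptyset}/{G^*}^{\infty}_{\emptyset}$ is also non-abelian.
   Context: The weight of a topological space is the minimal cardinality of a base of its topology. A monster model (sufficiently saturated extension) $G^*$ of a group $(G,\cdot,\dots)$ with first-order structure is a $\kappa$-saturated and $\kappa$-strongly homogeneous elementary extension, for a sufficiently big cardinal $\kappa$; ''small'' means of cardinality $<\kappa$, and an $A$-invariant subgroup (invariant under automorphisms of $G^*$ fixing the small set $A$ pointwise) has bounded index if its index in $G^*$ is $<\kappa$. ${G^*}^{00}_{A}$ is the intersection of all subgroups of $G^*$ of bounded index that are type-definable over $A$; ${G^*}^{\infty}_{A}$ is the intersection of all $A$-invariant subgroups of $G^*$ of bounded index. Both are normal subgroups of bounded index and ${G^*}^{\infty}_A\subseteq {G^*}^{00}_A$. A subset $P$ of a group $G$ is $n$-thick if $P=P^{-1}$ and for every sequence $g_1,\dots,g_n$ in $G$ (not necessarily distinct) there are $1\le i<j\le n$ with $g_i^{-1}g_j\in P$; thick means $n$-thick for some $n\in\mathbb{N}$. A group $G$ is type-absolutely connected if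 for any sufficiently saturated extension $G^*$ of any first-order expansion of $G$ one has $G^*={G^*}^{00}_G$; equivalently, for every family $\{P_n:n\in\mathbb{N}\}$ of thick subsets of $G$ with $P_{n+1}P_{n+1}\subseteq P_n$ for all $n$, one has $P_n=G$ for all $n$. *)

(* Defs.v *)
From HB Require Import structures.
From mathcomp Require Import all_boot all_classical topology.

Set Implicit Arguments.
Unset Strict Implicit.
Unset Printing Implicit Defensive.

Local Open Scope classical_set_scope.
Local Open Scope card_scope.
Local Open Scope group_scope.

HB.mixin Record isTopologicalGroup T of Topological T & Group T := {
  mulg_continuous : continuous (fun xy : T * T => xy.1 * xy.2);
  invg_continuous : continuous (fun x : T => x^-1)
}.

#[short(type="topologicalGroupType")]
HB.structure Definition TopologicalGroup :=
  {T of Topological T & Group T & isTopologicalGroup T}.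

Definition weight_le (T : topologicalType) (U : Type) (C : set U) :=
  exists2 B : set (set T), B #<= C & basis B.

Definition abelian_group (G : groupType) := forall x y : G, commute x y.

Definition is_subgroup (G : groupType) (H : set G) :=
  [/\ H 1, forall x y, H x -> H y -> H (x * y) & forall x, H x -> H x^-1].

Definition left_coset (G : groupType) (H : set G) (x : G) : set G :=
  [set x * h | h in H].

Definition is_normal_in (G : groupType) (N H : set G) :=
  [/\ is_subgroup H, is_subgroup N, N `<=` H &
      forall h n, H h -> N n -> N (n ^ h)].

(* The group H / N, as the set of the cosets x N with x in H, under the *)
(* product of subsets. *)
Definition quotient_group (G : groupType) (N H : set G)
    (nNH : is_normal_in N H) : Type :=
  {C : set G | exists2 x, H x & C = left_coset N x}.

Section QuotientGroup.
Variables (G : groupType) (N H : set G) (nNH : is_normal_in N H).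

Let T := quotient_group nNH.

HB.instance Definition _ := gen_eqMixin (quotient_group nNH).
HB.instance Definition _ := gen_choiceMixin (quotient_group nNH).

Let mul_set (C D : set G) : set G := [set x * y | x in C & y in D].
Let inv_set (C : set G) : set G := [set x^-1 | x in C].

Lemma mul_left_coset x y : H x -> H y ->
  mul_set (left_coset N x) (left_coset N y) = left_coset N (x * y).
Proof.
case: nNH => -[H1 HM HV] [N1 NM NV] sNH NJ Hx Hy; apply/seteqP; split.
  move=> _ [_ [n Nn <-]] [_ [m Nm <-]] <-; exists (n ^ y * m).
    by apply: NM => //; exact: NJ.
  by rewrite conjgE !mulgA mulgK.
move=> _ [n Nn <-]; exists x; first by exists 1; rewrite ?mulg1.
by exists (y * n); rewrite ?mulgA //; exists n.
Qed.

Lemma inv_left_coset x : H x ->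
  inv_set (left_coset N x) = left_coset N x^-1.
Proof.
case: nNH => -[H1 HM HV] [N1 NM NV] sNH NJ Hx; apply/seteqP; split.
  move=> _ [_ [n Nn <-]] <-; exists (n^-1 ^ x^-1).
    by apply: NJ; [exact: HV|exact: NV].
  by rewrite conjgE invgK invgM !mulgA mulVg mul1g.
move=> _ [n Nn <-]; exists (x * (n^-1 ^ x)).
  by exists (n^-1 ^ x) => //; apply: NJ => //; exact: NV.
by rewrite conjgE !mulgA mulgV mul1g invgM invgK.
Qed.

Let quotient_repr (C : T) : exists2 x, H x & sval C = left_coset N x.
Proof. exact: (proj2_sig C). Qed.

Let mulT_subproof (C D : T) :
  exists2 x, H x & mul_set (sval C) (sval D) = left_coset N x.
Proof.
have [x Hx ->] := quotient_repr C; have [y Hy ->] := quotient_repr D.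
exists (x * y); last exact: mul_left_coset.
by case: nNH => -[_ HM _] _ _ _; exact: HM.
Qed.

Let invT_subproof (C : T) :
  exists2 x, H x & inv_set (sval C) = left_coset N x.
Proof.
have [x Hx ->] := quotient_repr C.
exists x^-1; last exact: inv_left_coset.
by case: nNH => -[_ _ HV] _ _ _; exact: HV.
Qed.

Let oneT_subproof : exists2 x, H x & N = left_coset N x.
Proof.
exists 1; first by case: nNH => -[].
by rewrite /left_coset (_ : *%g 1 = id) ?image_id//; apply/funext => x; rewrite mul1g.
Qed.

Definition quotient_mul (C D : T) : T :=
  exist _ (mul_set (sval C) (sval D)) (mulT_subproof C D).
Definition quotient_inv (C : T) : T :=
  exist _ (inv_set (sval C)) (invT_subproof C).
Definition quotient_one : T := exist _ N oneT_subproof.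

Let val_one : sval quotient_one = left_coset N 1.
Proof.
by rewrite /= /left_coset (_ : *%g 1 = id) ?image_id//; apply/funext => x; rewrite mul1g.
Qed.

Let subH1 : H 1. Proof. by case: nNH => -[]. Qed.
Let subHM x y : H x -> H y -> H (x * y).
Proof. by case: nNH => -[_ HM _] _ _ _; exact: HM. Qed.
Let subHV x : H x -> H x^-1.
Proof. by case: nNH => -[_ _ HV] _ _ _; exact: HV. Qed.

Let sval_inj (C D : T) : sval C = sval D -> C = D.
Proof. by case: C D => [C pC] [D pD] /= CD; exact: eq_exist. Qed.

Let quotient_mulA : associative quotient_mul.
Proof.
move=> C D E; apply: sval_inj => /=.
have [x Hx ->] := quotient_repr C; have [y Hy ->] := quotient_repr D.
have [z Hz ->] := quotient_repr E.
by rewrite !mul_left_coset ?mulgA//; exact: subHM.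
Qed.

Let quotient_mul1 : left_id quotient_one quotient_mul.
Proof.
move=> C; apply: sval_inj.
rewrite -[RHS]/(sval C) -[LHS]/(mul_set (sval quotient_one) (sval C)) val_one.
by have [x Hx ->] := quotient_repr C; rewrite mul_left_coset ?mul1g.
Qed.

Let quotient_mulr1 : right_id quotient_one quotient_mul.
Proof.
move=> C; apply: sval_inj.
rewrite -[RHS]/(sval C) -[LHS]/(mul_set (sval C) (sval quotient_one)) val_one.
by have [x Hx ->] := quotient_repr C; rewrite mul_left_coset ?mulg1.
Qed.

Let quotient_mulV : left_inverse quotient_one quotient_inv quotient_mul.
Proof.
move=> C; apply: sval_inj.
rewrite -[RHS]/(sval quotient_one) val_one /=.
have [x Hx ->] := quotient_repr C.
by rewrite inv_left_coset// mul_left_coset ?mulVg//; exact: subHV.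
Qed.

Let quotient_mulrV : right_inverse quotient_one quotient_inv quotient_mul.
Proof.
move=> C; apply: sval_inj.
rewrite -[RHS]/(sval quotient_one) val_one /=.
have [x Hx ->] := quotient_repr C.
by rewrite inv_left_coset// mul_left_coset ?mulgV//; exact: subHV.
Qed.

HB.instance Definition _ := isGroup.Build (quotient_group nNH)
  quotient_mulA quotient_mul1 quotient_mulr1 quotient_mulV quotient_mulrV.

End QuotientGroup.

Definition product_group (I : Type) (G : I -> groupType) : Type :=
  forall i, G i.

Section ProductGroup.
Variables (I : Type) (G : I -> groupType).

Let T := product_group G.

HB.instance Definition _ := gen_eqMixin (product_group G).
HB.instance Definition _ := gen_choiceMixin (product_group G).

Let mulT (f g : T) : T := fun i => f i * g i.
Let invT (f : T) : T := fun i => (f i)^-1.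
Let oneT : T := fun=> 1.

Let mulTA : associative mulT.
Proof. by move=> f g h; apply: functional_extensionality_dep => i; exact: mulgA. Qed.
Let mul1T : left_id oneT mulT.
Proof. by move=> f; apply: functional_extensionality_dep => i; exact: mul1g. Qed.
Let mulT1 : right_id oneT mulT.
Proof. by move=> f; apply: functional_extensionality_dep => i; exact: mulg1. Qed.
Let mulVT : left_inverse oneT invT mulT.
Proof. by move=> f; apply: functional_extensionality_dep => i; exact: mulVg. Qed.
Let mulTV : right_inverse oneT invT mulT.
Proof. by move=> f; apply: functional_extensionality_dep => i; exact: mulgV. Qed.

HB.instance Definition _ := isGroup.Build (product_group G)
  mulTA mul1T mulT1 mulVT mulTV.

Definition direct_sum : set (product_group G) :=
  [set f | finite_set [set i | f i <> 1]].

Lemma direct_sum_normal : is_normal_in direct_sum [set: product_group G].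
Proof.
split=> //; last first.
  move=> h f _; apply: sub_finite_set => i /=; apply: contra_not => fi1.
  by rewrite -[LHS]/((h i)^-1 * (f i * h i)) fi1 mul1g mulVg.
split=> /=.
- by apply: (@sub_finite_set _ _ set0) => // i /=; apply.
- move=> f g fd gd; apply: (@sub_finite_set _ _
    ([set i | f i <> 1] `|` [set i | g i <> 1])); last by rewrite finite_setU.
  move=> i /= fgi; apply: contrapT => /not_orP[/contrapT fi1 /contrapT gi1].
  by apply: fgi; rewrite -[LHS]/(f i * g i) fi1 gi1 mul1g.
- move=> f; apply: sub_finite_set => i /=; apply: contra_not => fi1.
  by rewrite -[LHS]/((f i)^-1) fi1 invg1.
Qed.

End ProductGroup.

(* Cardinals are represented by types. The universe is the one of the carriers *)
(* of groups: in a larger one, a "sufficiently big" cardinal could exceed the *)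
(* cardinality of every group, and there would be no saturated model. *)
Definition cardinal := Type@{Group.axioms_.u0}.

Definition small (K : cardinal) (T : Type) (A : set T) :=
  ~ ([set: K] #<= A).

Definition for_sufficiently_big (P : cardinal -> Prop) :=
  exists K0 : cardinal, forall K : cardinal, [set: K0] #<= [set: K] -> P K.

(* The symbols of a first-order language besides those of the group language, *)
(* which are built into the terms below. *)
Record language := Language {
  fun_symbol : Type@{Group.axioms_.u0};
  fun_arity : fun_symbol -> nat;
  rel_symbol : Type@{Group.axioms_.u0};
  rel_arity : rel_symbol -> nat
}.

Record expansion (L : language) (G : groupType) := Expansion {
  fun_interp : forall f : fun_symbol L, ('I_(fun_arity f) -> G) -> G;
  rel_interp : forall r : rel_symbol L, ('I_(rel_arity r) -> G) -> Prop
}.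

Inductive term (L : language) (V : Type) :=
| TVar of V
| TOne
| TInv of term L V
| TMul of term L V & term L V
| TFun (f : fun_symbol L) of ('I_(fun_arity f) -> term L V).

(* First-order formulas with free variables in V; in FAll the new variable is *)
(* None. With V := A or V := option A, where A is a subset of a structure, *)
(* these are the sentences, resp. the formulas in one variable, with *)
(* parameters in A. *)
Inductive formula (L : language) (V : Type) :=
| FFalse
| FEq of term L V & term L V
| FRel (r : rel_symbol L) of ('I_(rel_arity r) -> term L V)
| FImp of formula L V & formula L V
| FAll of formula L (option V).

Section Semantics.
Variables (L : language) (G : groupType) (S : expansion L G).

Fixpoint eval V (v : V -> G) (t : term L V) : G :=
  match t with
  | TVar x => v x
  | TOne => 1
  | TInv t => (eval v t)^-1
  | TMul t u => eval v t * eval v u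
  | TFun f ts => fun_interp S (fun i => eval v (ts i))
  end.

Fixpoint sat V (v : V -> G) (phi : formula L V) : Prop :=
  match phi with
  | FFalse => False
  | FEq t u => eval v t = eval v u
  | FRel r ts => rel_interp S (fun i => eval v (ts i))
  | FImp phi psi => sat v phi -> sat v psi
  | FAll phi => forall x : G, sat (oapp v x) phi
  end.

Definition realizes (A : set G) (p : set (formula L (option A))) (x : G) :=
  forall phi, p phi -> sat (oapp val x) phi.

Definition saturated (K : cardinal) :=
  forall A : set G, small K A -> forall p : set (formula L (option A)),
    (forall q, finite_set q -> q `<=` p -> exists x, realizes q x) ->
    exists x, realizes p x.

Definition automorphism (s : G -> G) :=
  [/\ bijective s,
      {morph s : x y / x * y},
      forall f (xs : 'I_(fun_arity f) -> G),
        s (fun_interp S xs) = fun_interp S (s \o xs) &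
      forall r (xs : 'I_(rel_arity r) -> G),
        rel_interp S (s \o xs) <-> rel_interp S xs].

Definition elementary_map (A : set G) (f : A -> G) :=
  forall phi : formula L A, sat val phi <-> sat f phi.

Definition strongly_homogeneous (K : cardinal) :=
  forall A : set G, small K A -> forall f : A -> G, elementary_map f ->
    exists2 s, automorphism s & forall a : A, s (val a) = f a.

Definition bounded_index (K : cardinal) (H : set G) :=
  small K (range (left_coset H)).

Definition invariant (A H : set G) :=
  forall s, automorphism s -> (forall a, A a -> s a = a) -> s @` H = H.

Definition type_definable (A H : set G) :=
  exists p : set (formula L (option A)), H = [set x | realizes p x].

Definition component00 (K : cardinal) (A : set G) : set G :=
  \bigcap_(H in [set H | [/\ is_subgroup H, type_definable A H &
                             bounded_index K H]]) H.

Definition component_infty (K : cardinal) (A : set G) : set G :=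
  \bigcap_(H in [set H | [/\ is_subgroup H, invariant A H &
                             bounded_index K H]]) H.

End Semantics.

Definition elementary_embedding (L : language) (G H : groupType)
    (S : expansion L G) (S' : expansion L H) (e : G -> H) :=
  forall phi : formula L G, sat S id phi <-> sat S' e phi.

Definition monster_model (K : cardinal) (L : language) (G Gs : groupType)
    (S : expansion L G) (Ss : expansion L Gs) (e : G -> Gs) :=
  [/\ elementary_embedding S Ss e, saturated Ss K & strongly_homogeneous Ss K].

Definition type_absolutely_connected (G : groupType) :=
  forall (L : language) (S : expansion L G),
    for_sufficiently_big (fun K =>
      forall (Gs : groupType) (Ss : expansion L Gs) (e : G -> Gs),
        monster_model K S Ss e ->
        component00 Ss K (range e) = [set: Gs]).

Definition homomorphic_image_of (H G : groupType) :=
  exists f : {multiplicative G -> H}, range f = [set: H].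

(* Main.v *)
(* Let [A] be SL2 over the rationals and [X] the free product of copies of [A] *)
(* indexed by the pairs [(n, g)] with [g] in [G n]. Fix [a0] in [A] which is   *)
(* not its own inverse and let [f n] send a reduced word to the product of the *)
(* values of its letters, where the letter [a0] of the copy [(n, g)] has value *)
(* [g], its inverse has value [g^-1], and all other letters have value [1].    *)
(* In a product of two reduced words at most one pair of letters is merged     *)
(* without cancelling, so [f n (x * y) = f n x * f n y] for all but one [n].   *)
(* Put on [X] a predicate for each preimage under [f n] of a subset of [G n].  *)
(* By compactness the [f n] have standard parts on a monster model [Xs], and   *)
(* these define a homomorphism from [Xs] to the product modulo the direct sum. *)
(* It is onto by saturation, and its kernel is invariant of bounded index.     *)
(*                                                                             *)
(* The component 00 is everything because [X] is generated by unipotents, each *)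
(* of which is, for a sequence of diagonal matrices [Y i], a commutator of     *)
(* every [(Y i)^-1 * Y j]: finitely many translates of a definable set [D]     *)
(* containing a bounded type-definable subgroup cover [Xs], hence by the       *)
(* pigeonhole principle [D] contains all conjugates of some [(Y i)^-1 * Y j].  *)
(*                                                                             *)
(* The component infinity is normal because the index of an invariant subgroup *)
(* of bounded index is bounded by the number of ultrafilters on [X], whatever  *)
(* the saturation of [Xs]; so its normal core is also of bounded index.        *)
From HB Require Import structures.
Require Import Defs.
From mathcomp Require Import all_boot all_order all_algebra ring.
From mathcomp Require Import all_classical topology.

Set Implicit Arguments.
Unset Strict Implicit.
Unset Printing Implicit Defensive.

Local Open Scope classical_set_scope.
Local Open Scope card_scope.
Local Open Scope group_scope.

(** * Cardinals *)

(** The maps [word_map n] from the free product [X] to the groups [G n] take prescribed values on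
    the letters [a0], yet are jointly almost multiplicative: a product of two words spoils at most
    one index ([weval_wmul], [word_map_almost_morph]). In a monster model each map acquires a
    standard part, by compactness of [G n]. That two distinct indices never fail together is a
    first-order fact, so at most one index fails there too ([standard_part_morph2]), and the classes
    of standard parts form a homomorphism onto the product modulo the direct sum
    ([standard_class_surj]). Automorphisms preserve standard parts and these determine the cosets of
    the kernel, so the kernel contains the infinity component.

    Surjectivity survives the restriction to the 00 component, because that component is everything:
    [infinitely_commutator_mem] puts the unipotents, which generate [X], into every type-definable
    subgroup of bounded index. The quotient is a group because the infinity component is normal, by
    [coheir_coset] and [conj_core_card]. Finally, homomorphic images of abelian groups are abelian,
    so [product_mod_sum_nonabelian] gives the last claim. *)

Lemma cardT_leP (K T : Type) (A : set T) :
  [set: K] #<= A <-> exists2 f : K -> T, injective f & forall k, A (f k).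
Proof.
split=> [/card_leP[g]|[f finj fA]].
  have inT (k : K) : k \in [set: K] by rewrite inE.
  exists (fun k => val (g (exist _ k (inT k)))) => [k l|k].
    move=> /val_inj /(injT (f := g)) e.
    by have := congr1 (@sval _ _) e.
  by apply: set_mem; exact: valP.
apply: inj_card_le; apply: unsquash; apply/injfunPex.
by exists f => [k _|k l _ _]; [exact: fA|exact: finj].
Qed.

Lemma cardT_le (S T : Type) (f : S -> T) :
  injective f -> [set: S] #<= [set: T].
Proof. by move=> finj; apply/cardT_leP; exists f. Qed.

Lemma cantor (T : Type) : ~ ([set: set T] #<= [set: T]).
Proof.
move=> /cardT_leP[g ginj _]; pose D := [set t | exists2 A, t = g A & ~ A t].
have nD : ~ D (g D) by move=> /[dup] DgD [A /ginj <-].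
by apply: (nD); exists D.
Qed.

Lemma small_le (K : cardinal) (S T : Type) (A : set S) (B : set T) :
  A #<= B -> small K B -> small K A.
Proof. by move=> AB sB KA; apply: sB; exact: card_le_trans KA AB. Qed.

Lemma small_le_type (K : cardinal) (S T : Type) (A : set S) :
  A #<= [set: T] -> [set: set T] #<= [set: K] -> small K A.
Proof.
by move=> AT TK KA; apply: (@cantor T); exact: card_le_trans (card_le_trans TK KA) AT.
Qed.

(** Serves to count cosets by labels that depend on a representative: choice picks one label for
    each element, and the second hypothesis makes the labels injective. *)
Lemma card_le_rel (S T : Type) (A : set S) (B : set T) (R : S -> T -> Prop) :
  (forall x, A x -> exists2 y, B y & R x y) ->
  (forall x x' y, A x -> A x' -> R x y -> R x' y -> x = x') -> A #<= B.
Proof.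
move=> RAB Rinj; have r (x : A) : exists y : B, R (val x) (val y).
  have [y By Rxy] := RAB _ (set_mem (valP x)).
  by exists (exist _ y (mem_set By)).
have [f fR] := choice r; apply/card_leP; apply/injfunPex; exists f => // x x' _ _ fxx'.
apply: val_inj; apply: (Rinj _ _ (val (f x))); try exact: (set_mem (valP _)).
  exact: fR.
by rewrite fxx'.
Qed.

(** Zorn on graphs of partial injections: a maximal graph missing both some [t] and some [u] could
    be extended by [(t, u)]. *)
Lemma card_comparable (T U : Type) :
  [set: T] #<= [set: U] \/ [set: U] #<= [set: T].
Proof.
pose P := [set S : set (T * U) | forall p q, S p -> S q -> p.1 = q.1 <-> p.2 = q.2].
have [|S [PS Smax]] := @Zorn_bigcup _ P.
  move=> F FP Ftot p q [X FX Xp] [Y FY Yq].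
  by have [XY|YX] := Ftot _ _ FX FY;
     [apply: (FP _ FY) => //; exact: XY|apply: (FP _ FX) => //; exact: YX].
have [St|/existsNP[t tS]] := pselect (forall t, exists u, S (t, u)).
  left; have [g gS] := choice St; apply: (@cardT_le _ _ g) => t t' gtt'.
  by apply: (proj2 (PS _ _ (gS t) (gS t'))).
have [Su|/existsNP[u uS]] := pselect (forall u, exists t, S (t, u)).
  right; have [g gS] := choice Su; apply: (@cardT_le _ _ g) => v v' gvv'.
  by apply: (proj1 (PS _ _ (gS v) (gS v'))).
exfalso; apply: (Smax (S `|` [set (t, u)])).
  split; first by left.
  by move=> /(_ (t, u) (or_intror erefl)) Stu; apply: tS; exists u.
move=> [a b] [c d] [Sab|[-> ->]] [Scd|[-> ->]] //=; first exact: (PS _ _ Sab Scd).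
- by split=> e; [case: tS; exists b; rewrite -e|case: uS; exists a; rewrite -e].
- by split=> e; [case: tS; exists d; rewrite e|case: uS; exists c; rewrite e].
Qed.

(* If [K] injects into [C `|` A], then the part of [K] landing in [C] is not *)
(* below [T * nat], so [T * nat] embeds in it; shifting along [nat] there    *)
(* makes room for the remaining part of [K].                                 *)
Lemma small_setU (K : cardinal) (S T : Type) (A C : set S) :
  A #<= [set: T] -> [set: set (T * nat)] #<= [set: K] ->
  small K C -> small K (C `|` A).
Proof.
move=> AT TK sC /cardT_leP[i iinj iCA]; apply: sC.
pose KC := {k : K | C (i k)}.
have KCinj (c d : KC) : sval c = sval d -> c = d.
  by case: c d => [c Cc] [d Cd] /= cd; exact: eq_exist.
have {AT}[v vinj] : exists v : K -> option T,
    forall k l, ~ C (i k) -> ~ C (i l) -> v k <> None /\ (v k = v l -> k = l).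
  case/card_leP: AT => g.
  pose v k := if pselect (A (i k)) is left Ak
    then Some (val (g (exist _ (i k) (mem_set Ak)))) else None.
  have vE k : ~ C (i k) -> A (i k) by case: (iCA k).
  exists v => k l /vE Ak /vE Al; rewrite /v.
  case: pselect => // {}Ak; case: pselect => // {}Al; split=> //.
  move=> -[/val_inj /(injT (f := g)) e].
  by apply: iinj; have := congr1 (@sval _ _) e.
have [|] := card_comparable (T * nat) KC.
  move=> /cardT_leP[u uinj _]; apply/cardT_leP.
  have next (k : K) : exists c : KC,
      if pselect (C (i k)) then
        (exists p, k = sval (u p) /\ c = u (p.1, p.2.+1)) \/
        (~ (exists p, k = sval (u p)) /\ k = sval c)
      else exists t, v k = Some t /\ c = u (t, 0%N).
    case: pselect => Ck; last first.
      case vk: (v k) => [t|]; first by exists (u (t, 0%N)), t.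
      by have [] := vinj k k Ck Ck.
    have [[p kp]|np] := pselect (exists p, k = sval (u p)).
      by exists (u (p.1, p.2.+1)); left; exists p.
    by exists (exist _ k Ck); right.
  have [s sP] := choice next; exists (fun k => i (sval (s k))); last first.
    by move=> k; exact: (proj2_sig (s k)).
  move=> k l /iinj/KCinj skl; move: (sP k) (sP l); rewrite -skl.
  case: pselect => Ck; case: pselect => Cl.
  - move=> [[p [kp sp]]|[np kp]] [[q [lq sq]]|[nq lq]].
    + move: sp; rewrite sq => /uinj[e1 e2]; rewrite kp lq.
      by congr (sval (u _)); rewrite [p]surjective_pairing [q]surjective_pairing e1 e2.
    + by case: nq; exists (p.1, p.2.+1); rewrite lq sp.
    + by case: np; exists (q.1, q.2.+1); rewrite kp sq.
    + by rewrite kp lq.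
  - move=> [[p [kp ->]]|[np kp]] [t [vt e]]; first by have [] := uinj _ _ e.
    by case: np; exists (t, 0%N); rewrite kp e.
  - move=> [t [vt ->]] [[p [kp e]]|[np kp]]; first by have [] := uinj _ _ e.
    by case: np; exists (t, 0%N); rewrite kp.
  - move=> [t [vt ->]] [t' [vt' /uinj[e]]].
    by have [_] := vinj k l Ck Cl; apply; rewrite vt vt' e.
move=> /cardT_leP[w winj _]; exfalso; apply: (@cantor (T * nat)).
apply: (card_le_trans TK); apply/cardT_leP.
have code (k : K) : exists p : T * nat,
    if pselect (C (i k)) is left Ck
    then p = ((w (exist _ k Ck)).1, (w (exist _ k Ck)).2.+1)
    else v k = Some p.1 /\ p.2 = 0%N.
  case: pselect => Ck; first by eexists.
  by have [+ _] := vinj k k Ck Ck; case: (v k) => // t _; exists (t, 0%N).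
have [s sP] := choice code; exists s => // k l skl.
move: (sP k) (sP l); rewrite -skl.
case: pselect => Ck; case: pselect => Cl.
- move=> -> [e1 e2]; have : w (exist _ k Ck) = w (exist _ l Cl).
    by rewrite [LHS]surjective_pairing [RHS]surjective_pairing e1 e2.
  by move=> /winj/(congr1 (@sval _ _)).
- by move=> -> [].
- by move=> [_ e0] e; move: e0; rewrite e.
- move=> [vk _] [vl _]; have [_] := vinj k l Ck Cl.
  by apply; rewrite vk vl.
Qed.

(** * Formulas and definable sets *)

Section Formulas.
Variable L : language.

Fixpoint trename V W (r : V -> W) (t : term L V) : term L W :=
  match t with
  | TVar x => TVar L (r x)
  | TOne => TOne L W
  | TInv t => TInv (trename r t)
  | TMul t u => TMul (trename r t) (trename r u)
  | TFun f ts => TFun (fun i => trename r (ts i))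
  end.

Fixpoint frename V W (r : V -> W) (phi : formula L V) : formula L W :=
  match phi with
  | FFalse => FFalse L W
  | FEq t u => FEq (trename r t) (trename r u)
  | FRel s ts => FRel (fun i => trename r (ts i))
  | FImp phi psi => FImp (frename r phi) (frename r psi)
  | FAll phi => FAll (frename (omap r) phi)
  end.

Definition FNot V (phi : formula L V) := FImp phi (FFalse L V).
Definition FAnd V (phi psi : formula L V) := FNot (FImp phi (FNot psi)).
Definition FEx V (phi : formula L (option V)) := FNot (FAll (FNot phi)).

(* [finst phi r t] is [phi] with its variable [None] replaced by the term [t]; *)
(* it is written as [forall w, w = t -> phi w], so that no substitution of    *)
(* terms is needed.                                                           *)
Definition finst V W (phi : formula L (option V)) (r : V -> W) (t : term L W) :=
  FAll (FImp (FEq (TVar L None) (trename Some t)) (frename (omap r) phi)).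

Variables (G : groupType) (S : expansion L G).

Lemma eval_trename V W (r : V -> W) (t : term L V) (v : W -> G) :
  Defs.eval S v (trename r t) = Defs.eval S (v \o r) t.
Proof.
elim: t => //= [t ->|t -> u ->|f ts IH] //.
by congr fun_interp; apply/funext => i; exact: IH.
Qed.

Lemma oapp_omap V W (r : V -> W) (v : W -> G) (x : G) :
  oapp v x \o omap r = oapp (v \o r) x.
Proof. by apply/funext => -[]. Qed.

Lemma sat_frename V W (r : V -> W) (phi : formula L V) (v : W -> G) :
  sat S v (frename r phi) <-> sat S (v \o r) phi.
Proof.
elim: phi W r v => //= {V} V.
- by move=> t u W r v; rewrite !eval_trename.
- move=> s ts W r v; suff -> : (fun i => Defs.eval S v (trename r (ts i))) =
    (fun i => Defs.eval S (v \o r) (ts i)) by [].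
  by apply/funext => i; rewrite eval_trename.
- by move=> phi IHphi psi IHpsi W r v; rewrite IHphi IHpsi.
- by move=> phi IH W r v; split=> h x; have := h x; rewrite IH oapp_omap.
Qed.

Lemma satA V (v : V -> G) phi psi :
  sat S v (FAnd phi psi) <-> sat S v phi /\ sat S v psi.
Proof.
split=> /= [h|[h1 h2]]; last by apply.
by apply: contrapT => /not_andP h'; apply: h => h1 h2; case: h'.
Qed.

Lemma satE V (v : V -> G) phi :
  sat S v (FEx phi) <-> exists x, sat S (oapp v x) phi.
Proof.
split=> /= [h|[x hx]]; last by move=> /(_ x hx).
by apply: contrapT => h'; apply: h => x hx; apply: h'; exists x.
Qed.

Lemma sat_finst V W (phi : formula L (option V)) (r : V -> W) t (v : W -> G) :
  sat S v (finst phi r t) <-> sat S (oapp (v \o r) (Defs.eval S v t)) phi.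
Proof.
split=> [h|h x /= xt].
  have /sat_frename := h _ (esym (eval_trename Some t (oapp v (Defs.eval S v t)))).
  by rewrite oapp_omap.
by apply/sat_frename; rewrite oapp_omap xt eval_trename.
Qed.

Definition definable (A D : set G) :=
  exists phi : formula L (option A), D = [set x | sat S (oapp val x) phi].

Lemma definable_inst (A : set G) V (v : V -> G) (phi : formula L (option V)) :
  (forall i, A (v i)) -> definable A [set x | sat S (oapp v x) phi].
Proof.
move=> Av; pose r i : A := exist _ (v i) (mem_set (Av i)).
exists (frename (omap r) phi); apply/seteqP.
by split=> x /=; rewrite sat_frename oapp_omap.
Qed.

Lemma definable_mono (A B D : set G) : A `<=` B -> definable A D -> definable B D.
Proof.
move=> AB [phi ->]; apply: definable_inst => i; apply: AB.
exact: (set_mem (valP i)).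
Qed.

Lemma type_definable_mono (A B H : set G) :
  A `<=` B -> type_definable S A H -> type_definable S B H.
Proof.
move=> AB [p ->].
pose r (a : A) : B := exist _ (val a) (mem_set (AB _ (set_mem (valP a)))).
exists (frename (omap r) @` p); apply/seteqP; split=> x xp phi.
  by move=> [psi ppsi <-]; apply/sat_frename; rewrite oapp_omap; exact: xp.
move=> pphi; have /sat_frename : sat S (oapp val x) (frename (omap r) phi).
  by apply: xp; exists phi.
by rewrite oapp_omap.
Qed.

Lemma definableI (A D E : set G) :
  definable A D -> definable A E -> definable A (D `&` E).
Proof.
move=> [phi ->] [psi ->]; exists (FAnd phi psi).
by apply/seteqP; split=> x; [move=> h; apply/satA|move=> /satA].
Qed.

Lemma definableC (A D : set G) : definable A D -> definable A (~` D).
Proof. by move=> [phi ->]; exists (FNot phi). Qed.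

Lemma definableT (A : set G) : definable A setT.
Proof. by exists (FNot (FFalse _ _)); apply/seteqP; split=> x _ //= []. Qed.

Lemma definable_translate (A D : set G) g :
  A g -> definable A D -> definable A [set x | D (g^-1 * x)].
Proof.
move=> Ag [phi ->]; pose a : A := exist _ g (mem_set Ag).
exists (finst phi Some (TMul (TInv (TVar L (Some a))) (TVar L None))).
by apply/seteqP; split=> x; [move=> h; apply/sat_finst|move=> /sat_finst].
Qed.

(** Saturation as compactness: by directedness, finitely many formulas defining members of [F] all
    follow from a single member, which is nonempty. *)
Lemma saturated_directed (K : cardinal) (A : set G) (F : set (set G)) :
  saturated S K -> small K A -> F !=set0 ->
  (forall D, F D -> definable A D /\ D !=set0) ->
  (forall D E, F D -> F E -> exists2 E', F E' & E' `<=` D `&` E) ->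
  exists x, forall D, F D -> D x.
Proof.
move=> sat_S sA [D0 FD0] Fdef Fdir.
pose p := [set phi : formula L (option A) | F [set x | sat S (oapp val x) phi]].
have [|x px] := sat_S A sA p; last first.
  by exists x => D /[dup] FD /Fdef[[phi Dphi] _]; rewrite Dphi; apply: px; rewrite /p /= -Dphi.
move=> q qfin qp; suff [D FD Dq] : exists2 D, F D & forall x, D x -> realizes S q x.
  by have [_ [x Dx]] := Fdef D FD; exists x; exact: Dq.
have [s qs] := (@finite_seqP {classic (formula L (option A))} q).1 qfin.
have : forall phi, phi \in s -> p phi by move=> phi phis; apply: qp; rewrite qs.
rewrite /realizes qs {qs qfin qp}.
elim: s => [|phi s IH] sp; first by exists D0.
have [D FD Ds] : exists2 D, F D & forall x, D x ->
    forall psi, psi \in s -> sat S (oapp val x) psi.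
  by apply: IH => psi spsi; apply: sp; rewrite inE spsi orbT.
have [E FE ED] := Fdir _ _ FD (sp phi (mem_head _ _)).
exists E => // x /ED[Dx phix] psi /=; rewrite inE => /orP[/eqP->//|].
exact: Ds.
Qed.

End Formulas.

(** * Cosets and transversals *)

Lemma left_coset_eq (G : groupType) (H : set G) x y : is_subgroup H ->
  left_coset H x = left_coset H y <-> H (x^-1 * y).
Proof.
move=> [H1 HM HV]; split=> [xy|Hxy].
  have : left_coset H y y by exists 1; rewrite ?mulg1.
  by rewrite -xy => -[h Hh <-]; rewrite mulKg.
apply/seteqP; split=> _ [h Hh <-].
  exists ((x^-1 * y)^-1 * h); first by apply: HM => //; exact: HV.
  by rewrite invgM invgK !mulgA mulgV mul1g.
by exists (x^-1 * y * h); [exact: HM|rewrite !mulgA mulgV mul1g].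
Qed.

Lemma coset_div (G : groupType) (H : set G) x y z : is_subgroup H ->
  H (z^-1 * x) -> H (z^-1 * y) -> H (x^-1 * y).
Proof.
move=> [H1 HM HV] Hx Hy; have := HM _ _ (HV _ Hx) Hy.
by rewrite invgM invgK mulgA mulgK.
Qed.

Lemma coset_sym (G : groupType) (H : set G) x y : is_subgroup H ->
  H (x^-1 * y) -> H (y^-1 * x).
Proof. by move=> [H1 HM HV] /HV; rewrite invgM invgK. Qed.

Lemma bounded_index_transversal (G : groupType) (K : cardinal) (H : set G) :
  is_subgroup H -> bounded_index K H ->
  exists2 C : set G, small K C & forall x, exists2 c, C c & H (c^-1 * x).
Proof.
move=> sgH Hbd.
have repP (c : set G) : exists x, range (left_coset H) c -> c = left_coset H x.
  have [[x _ <-]|nc] := pselect (range (left_coset H) c); first by exists x.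
  by exists 1.
have [rep {}repP] := choice repP; exists (rep @` range (left_coset H)).
  apply: small_le Hbd; apply: (@card_le_rel _ _ _ _ (fun x c => x = rep c)).
    by move=> _ [c Cc <-]; exists c.
  by move=> x y c _ _ -> ->.
move=> x; have Cx : range (left_coset H) (left_coset H x) by exists x.
exists (rep (left_coset H x)); first by exists (left_coset H x).
by apply/left_coset_eq => //; exact/esym/repP.
Qed.

(** * Elementary embeddings of groups *)

Section ElementaryEmbedding.
Variables (L : language) (X Xs : groupType).
Variables (S : expansion L X) (Ss : expansion L Xs) (e : X -> Xs).
Hypothesis emb : elementary_embedding S Ss e.

Lemma embM : {morph e : x y / x * y}.
Proof.
move=> x y.
exact: ((emb (FEq (TVar L (x * y)) (TMul (TVar L x) (TVar L y)))).1 erefl).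
Qed.

Lemma emb1 : e 1 = 1.
Proof. exact: ((emb (FEq (TVar L 1) (TOne L X))).1 erefl). Qed.

Lemma embV : {morph e : x / x^-1}.
Proof.
by move=> x; exact: ((emb (FEq (TVar L x^-1) (TInv (TVar L x)))).1 erefl).
Qed.

Lemma card_range_emb : range e #<= [set: X].
Proof.
apply: (@card_le_rel _ _ _ _ (fun y x => y = e x)) => [_ [x _ <-]|y y' x _ _ -> ->//].
by exists x.
Qed.

(** Once the parameters are pulled back to [X], the statement that [D] is nonempty is an existential
    sentence, which transfers to [X] and has a witness there. *)
Lemma definable_emb_nonempty (D : set Xs) :
  definable Ss (range e) D -> D !=set0 -> exists m, D (e m).
Proof.
move=> [phi ->] [y phiy].
have rP (a : range e) : exists x, e x = val a.
  by case: (set_mem (valP a)) => x _ <-; exists x.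
have [r er] := choice rP.
pose psi := frename (omap r) phi.
have sat_psi m : sat Ss (oapp val (e m)) phi <-> sat S (oapp id m) psi.
  have -> : sat S (oapp id m) psi <-> sat S id (frename (oapp id m) psi).
    by rewrite sat_frename.
  rewrite emb /psi !sat_frename; suff -> : (e \o oapp id m) \o omap r = oapp val (e m) by [].
  by apply/funext => -[a|] //=.
have /(emb (FEx psi)).2/satE[m /sat_psi] : sat Ss e (FEx psi).
  apply/satE; exists y; rewrite sat_frename oapp_omap.
  by suff -> : e \o r = val by []; apply/funext => a; exact: er.
by exists m.
Qed.


End ElementaryEmbedding.

(** * A criterion for type-absolute connectedness *)

(** The commutator is written as a quotient of two conjugates of [(Y i)^-1 * Y j]; so [z] is caught
    as soon as all conjugates of one such element are small. *)
Definition infinitely_commutator (X : groupType) (z : X) :=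
  exists Y : nat -> X, forall i j, i != j ->
    exists w, z = (((Y i)^-1 * Y j) ^ w)^-1 * ((Y i)^-1 * Y j).

Section BoundedTypeDefinable.
Variables (L : language) (G : groupType) (S : expansion L G) (K : cardinal).
Hypothesis sat_S : saturated S K.
Variables (T : Type) (A H : set G).
Hypotheses (T_inh : inhabited T) (A_le : A #<= [set: T]).
Hypothesis T_le : [set: set (T * nat)] #<= [set: K].
Hypotheses (sgH : is_subgroup H) (Hdef : type_definable S A H).
Hypothesis Hbd : bounded_index K H.

(** Definable neighbourhoods of [H]; their intersection is [H] because [H] is type-definable. *)
Let D_ : set (set G) := [set D | definable S A D /\ H `<=` D].

Let D_I D E : D_ D -> D_ E -> D_ (D `&` E).
Proof.
move=> [dD HD] [dE HE]; split; first exact: definableI.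
by move=> x Hx; split; [exact: HD|exact: HE].
Qed.

Let D_T : D_ setT. Proof. by split=> //; exact: definableT. Qed.

Let D_H x : (forall D, D_ D -> D x) -> H x.
Proof.
case: Hdef => p Hp Dx; rewrite Hp => phi pphi.
by apply: (Dx [set y | sat S (oapp val y) phi]); split; [exists phi|rewrite Hp => y; exact].
Qed.

Let small_add C : small K C -> small K (C `|` A).
Proof. exact: small_setU A_le T_le. Qed.

Let sA : small K A.
Proof.
apply: small_le_type A_le _; apply: card_le_trans T_le.
apply: (@cardT_le _ _ (fun B => [set p | B p.1])) => B C /(congr1 (fun E t => E (t, 0%N))).
by move=> BC; apply/funext => t; have := congr1 (@^~ t) BC.
Qed.

Let sA1 x : small K (A `|` [set x]).
Proof.
apply: small_setU T_le sA; case: T_inh => t.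
by apply: (@card_le_rel _ _ _ _ (fun _ _ => True)) => [_ _|_ _ _ -> ->//]; exists t.
Qed.

(** Otherwise compactness gives [x0] and [y0] in the subgroup [H] with [x0 * y0^-1] outside [D].
    Saturation handles one variable at a time, so [y0] is found over [A] and [x0]. *)
Lemma bounded_definable_div D : definable S A D -> H `<=` D ->
  exists2 E, D_ E & forall x y, E x -> E y -> D (x * y^-1).
Proof.
move=> dD HD; apply: contrapT => nE.
have {}nE E : D_ E -> exists x y, [/\ E x, E y & ~ D (x * y^-1)].
  move=> DE; apply: contrapT => nxy; apply: nE; exists E => // x y Ex Ey.
  by apply: contrapT => nD; apply: nxy; exists x, y.
case: (dD) => phi Dphi.
pose F1 := [set [set x | exists y, [/\ E x, E y & ~ D (x * y^-1)]] | E in D_].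
have [|_ [E [dE HE] <-]|_ _ [E DE <-] [E' DE' <-]|x0 x0P] :=
    @saturated_directed _ _ S K A F1 sat_S sA.
- by exists [set x | exists y, [/\ setT x, setT y & ~ D (x * y^-1)]]; exists setT.
- split; last by have [x [y xy]] := nE E (conj dE HE); exists x, y.
  case: dE => psi Epsi.
  exists (FEx (FAnd (frename Some psi) (FAnd (finst psi (Some \o Some) (TVar L None))
     (FNot (finst phi (Some \o Some)
       (TMul (TVar L (Some None)) (TInv (TVar L None)))))))).
  apply/seteqP; split=> x.
    move=> [y [Ex Ey nD]]; apply/satE; exists y; apply/satA; split.
      by apply/sat_frename; move: Ex; rewrite Epsi.
    apply/satA; split; first by apply/sat_finst; move: Ey; rewrite Epsi.
    by move=> /sat_finst; move: nD; rewrite Dphi.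
  rewrite /mkset => /satE[y /satA[/sat_frename Ex /satA[/sat_finst Ey nD]]].
  exists y; rewrite Epsi Dphi; split=> // Dxy; apply: nD.
  exact/sat_finst.
- exists [set x | exists y, [/\ (E `&` E') x, (E `&` E') y & ~ D (x * y^-1)]].
    by exists (E `&` E') => //; exact: D_I.
  by move=> x [y [[Ex E'x] [Ey E'y] nD]]; split; exists y.
have {}x0P E : D_ E -> exists y, [/\ E x0, E y & ~ D (x0 * y^-1)].
  by move=> DE; apply: (x0P [set x | _]); exists E.
pose F2 := [set [set y | E y /\ ~ D (x0 * y^-1)] | E in D_].
have [|_ [E [dE HE] <-]|_ _ [E DE <-] [E' DE' <-]|y0 y0P] :=
    @saturated_directed _ _ S K (A `|` [set x0]) F2 sat_S (@sA1 x0).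
- by exists [set y | setT y /\ ~ D (x0 * y^-1)]; exists setT.
- split; last by have [y [_ Ey nD]] := x0P E (conj dE HE); exists y.
  apply: definableI; first by apply: definable_mono dE => x; left.
  apply: definableC; rewrite Dphi.
  pose a : (A `|` [set x0] : set G) := exist _ x0 (mem_set (or_intror erefl : (A `|` [set x0]) x0)).
  have [psi Dpsi] : definable S (A `|` [set x0]) D by apply: definable_mono dD => x; left.
  exists (finst psi Some (TMul (TVar L (Some a)) (TInv (TVar L None)))).
  rewrite -Dphi Dpsi; apply/seteqP.
  by split=> y; [move=> h; apply/sat_finst|move=> /sat_finst].
- exists [set y | (E `&` E') y /\ ~ D (x0 * y^-1)].
    by exists (E `&` E') => //; exact: D_I.
  by move=> y [[Ey E'y] nD].
have Hx0 : H x0 by apply: D_H => E /x0P[y []].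
have {}y0P E : D_ E -> E y0 /\ ~ D (x0 * y0^-1).
  by move=> DE; apply: (y0P [set y | _]); exists E.
have Hy0 : H y0 by apply: D_H => E /y0P[].
have [_] := y0P setT D_T; apply; apply: HD.
by case: sgH => _ HM HV; apply: HM => //; exact: HV.
Qed.

(** Otherwise saturation over a small transversal of [H] gives a point outside every translate of
    [D] by a representative, although the coset of that point lies in such a translate. *)
Lemma bounded_definable_cover D : D_ D ->
  exists s : seq G, forall x, exists2 g, g \in s & D (g^-1 * x).
Proof.
move=> [dD HD]; apply: contrapT => ns.
have {}ns (s : seq G) : exists x, forall g, g \in s -> ~ D (g^-1 * x).
  apply: contrapT => nx; apply: ns; exists s => x; apply: contrapT => ng.
  by apply: nx; exists x => g gs Dgx; apply: ng; exists g.
have [C sC CH] := bounded_index_transversal sgH Hbd.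
pose F := [set [set x | forall g, g \in s -> ~ D (g^-1 * x)] |
           s in [set s : seq G | forall g, g \in s -> C g]].
have [|_ [s sC' <-]|_ _ [s ssC <-] [t tC <-]|x0 x0P] :=
    @saturated_directed _ _ S K (C `|` A) F sat_S (small_add sC).
- by exists [set x | forall g, g \in [::] -> ~ D (g^-1 * x)]; exists [::].
- split; last exact: ns.
  have {}dD : definable S (C `|` A) D by apply: definable_mono dD => x; right.
  elim: s sC' => [|g s IH] sC'.
    suff -> : [set x | forall g, g \in [::] -> ~ D (g^-1 * x)] = setT by exact: definableT.
    by apply/seteqP; split.
  suff -> : [set x | forall h, h \in g :: s -> ~ D (h^-1 * x)] =
      ~` [set x | D (g^-1 * x)] `&` [set x | forall h, h \in s -> ~ D (h^-1 * x)].
    apply: definableI; last by apply: IH => h hs; apply: sC'; rewrite inE hs orbT.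
    by apply/definableC/definable_translate => //; left; apply: sC'; exact: mem_head.
  apply/seteqP; split=> x.
    move=> h; split; first by apply: h; exact: mem_head.
    by move=> k ks; apply: h; rewrite inE ks orbT.
  by move=> [h1 h2] k; rewrite inE => /orP[/eqP->//|]; exact: h2.
- exists [set x | forall g, g \in s ++ t -> ~ D (g^-1 * x)].
    by exists (s ++ t) => // g; rewrite mem_cat => /orP[/ssC|/tC].
  by move=> x h; split=> g gs; apply: h; rewrite mem_cat gs ?orbT.
have [c Cc Hcx0] := CH x0.
apply: (x0P [set x | forall g, g \in [:: c] -> ~ D (g^-1 * x)] _ c).
- by exists [:: c] => // g; rewrite inE => /eqP->.
- exact: mem_head.
exact: HD.
Qed.

(** Cover the group by translates [g D_4] and by translates [h D_5], and colour [i] by the [h] that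
    catch the finitely many conjugates [Y i ^ g]. Two indices share a colour, so
    [d = (Y i)^-1 * Y j] has [d ^ g] in [D_3] for each [g]. Any [x] is [g * u] with [u] in [D_4],
    and conjugating [d ^ g] by [u] stays within [D]. *)
Lemma bounded_definable_conj D (Y : nat -> G) : D_ D ->
  exists i j, i != j /\ forall x, D (((Y i)^-1 * Y j) ^ x).
Proof.
have H1 : H 1 by case: sgH.
have div E : D_ E -> exists2 E', D_ E' & forall x y, E' x -> E' y -> E (x * y^-1).
  by move=> [dE HE]; exact: bounded_definable_div.
have D1 E : D_ E -> E 1 by move=> [_]; exact.
move=> /div[D_1 /[dup] DD1 /div[D_2 DD2 D12] D01].
have /div[D_3 DD3 D23] := DD2; have /div[D_4 DD4 D34] := DD3.
have /div[D_5 DD5 D45] := DD4.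
have inv E E' x : D_ E' -> (forall x y, E' x -> E' y -> E (x * y^-1)) -> E' x -> E x^-1.
  by move=> DE' EE' E'x; rewrite -[x^-1]mul1g; apply: EE' => //; exact: D1.
have [gs gsP] := bounded_definable_cover DD4.
have [hs hsP] := bounded_definable_cover DD5.
have colP i : exists c : {ffun 'I_(size gs) -> 'I_(size hs)}, forall k,
    D_5 ((nth 1 hs (c k))^-1 * Y i ^ nth 1 gs k).
  have ck (k : 'I_(size gs)) : exists c : 'I_(size hs), D_5 ((nth 1 hs c)^-1 * Y i ^ nth 1 gs k).
    have [h hhs Dh] := hsP (Y i ^ nth 1 gs k).
    by move: (hhs); rewrite -index_mem => hlt; exists (Ordinal hlt); rewrite /= nth_index.
  by have [c cP] := choice ck; exists (finfun c) => k; rewrite ffunE.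
have [c cP] := choice colP.
have [i [j [ij cij]]] : exists i j, i != j /\ c i = c j.
  apply: contrapT => nij.
  pose N := #|{ffun 'I_(size gs) -> 'I_(size hs)}|.
  have : injective (fun i : 'I_N.+1 => c i).
    move=> i j cij; apply: contrapT => /eqP ij; apply: nij.
    by exists (i : nat), (j : nat).
  by move=> /leq_card; rewrite card_ord ltnn.
exists i, j; split=> // x.
have [g ggs D4g] := gsP x.
set d := (Y i)^-1 * Y j.
have D3d : D_3 (d ^ g).
  have := ggs; rewrite -index_mem => glt.
  have := cP i (Ordinal glt); have := cP j (Ordinal glt).
  rewrite -cij /= nth_index //; set h := nth _ _ _ => Dj Di.
  have -> : d ^ g = (h^-1 * Y i ^ g)^-1 * ((h^-1 * Y j ^ g)^-1)^-1.
    by rewrite invgK invgM invgK mulgA mulgK /d conjMg conjVg.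
  by apply: D34; apply: (inv D_4 D_5).
have D3u : D_3 (g^-1 * x)^-1 by apply: (inv D_3 D_4).
set u := g^-1 * x in D4g D3u *.
have -> : d ^ x = u^-1 * d ^ g * (u^-1)^-1.
  by rewrite invgK -mulgA -conjgE -conjgM /u mulVKg.
apply: D01.
  rewrite -[d ^ g]invgK; apply: D12; last by apply: (inv D_2 D_3).
  by rewrite -[u^-1]mulg1 -[X in _ * X]invg1; apply: D23 => //; exact: D1.
rewrite -[u^-1]mulg1 -[X in _ * X]invg1; apply: D12; last exact: D1.
by rewrite -[u^-1]mulg1 -[X in _ * X]invg1; apply: D23 => //; exact: D1.
Qed.

Lemma infinitely_commutator_mem z (Y : nat -> G) :
  (forall i j, i != j -> exists w, z = (((Y i)^-1 * Y j) ^ w)^-1 * ((Y i)^-1 * Y j)) ->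
  H z.
Proof.
move=> zY; apply: D_H => D [dD HD].
have [E DE DivE] := bounded_definable_div dD HD.
have [F DF DivF] : exists2 F, D_ F & forall x y, F x -> F y -> E (x * y^-1).
  by case: DE => dE HE; exact: bounded_definable_div.
have [i [j [ij FY]]] := bounded_definable_conj Y DF.
have inv x : F x -> E x^-1.
  move=> Fx; rewrite -[x^-1]mul1g; apply: DivF => //.
  by case: DF => _; apply; case: sgH.
have [w ->] := zY i j ij; rewrite -[X in _ * X]invgK; apply: DivE; apply: inv.
  exact: FY.
by have := FY 1; rewrite conjg1.
Qed.

End BoundedTypeDefinable.

(** A type-definable [H] of bounded index over [e X] pulls back to a subgroup of [X] containing the
    given generators, so it contains [e X]. Each formula of its type then holds on [e X], hence
    everywhere by elementarity. *)
Theorem type_absolutely_connected_criterion (X : groupType) :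
  (forall H : set X, is_subgroup H -> infinitely_commutator (X := X) `<=` H -> H = setT) ->
  type_absolutely_connected X.
Proof.
move=> gen L S; exists (set (X * nat)) => K TK Xs Ss e [emb sat_Ss _].
rewrite eqEsubset; split=> // y _ H [sgH Hdef Hbd].
have XH : e @^-1` H = setT.
  apply: gen.
    case: sgH => H1 HM HV; split=> [|x x'|x] /=.
    - by rewrite (emb1 emb).
    - by rewrite (embM emb); exact: HM.
    - by rewrite (embV emb); exact: HV.
  move=> z [Y zY]; rewrite /preimage /=.
  apply: (@infinitely_commutator_mem _ _ Ss K sat_Ss X (range e) H _ _ TK sgH Hdef Hbd _ (e \o Y)).
  - by constructor; exact: 1.
  - exact: card_range_emb.
  - move=> i j /zY[w ->]; exists (e w) => /=.
    by rewrite !conjgE !(embM emb, embV emb).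
case: (Hdef) => p Hp; rewrite Hp => phi pphi.
have Hphi x : H (e x) by rewrite -[H (e x)]/((e @^-1` H) x) XH.
apply: contrapT => nphi.
have [||m] := @definable_emb_nonempty _ _ _ _ _ _ emb
    (~` [set y | sat Ss (oapp val y) phi]).
- by apply: definableC; exists phi.
- by exists y.
by apply; move: (Hphi m); rewrite {1}Hp; exact.
Qed.

(** * Invariant subgroups of bounded index *)

Definition conj_core (G : groupType) (H : set G) : set G :=
  [set x | forall g, H (x ^ g)].

Lemma conj_core_subgroup (G : groupType) (H : set G) :
  is_subgroup H -> is_subgroup (conj_core H).
Proof.
move=> [H1 HM HV]; split=> [g|x y Hx Hy g|x Hx g]; first by rewrite conj1g.
  by rewrite conjMg; exact: HM.
by rewrite conjVg; exact: HV.
Qed.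

Section Automorphism.
Variables (L : language) (G : groupType) (S : expansion L G) (s : G -> G).
Hypothesis auts : automorphism S s.

Let sM : {morph s : x y / x * y}. Proof. by case: auts. Qed.

Lemma automorphismV : {morph s : x / x^-1}.
Proof.
have s1 : s 1 = 1 by apply: (@mulgI _ (s 1)); rewrite -sM !mulg1.
by move=> x; apply: (@mulgI _ (s x)); rewrite -sM !mulgV.
Qed.

Lemma automorphismJ : {morph s : x y / x ^ y}.
Proof. by move=> x y; rewrite !conjgE !sM automorphismV. Qed.

Lemma invariant_automorphism H x : Defs.invariant S set0 H -> H (s x) <-> H x.
Proof.
move=> /(_ s auts) sH; have {}sH : s @` H = H by exact: sH.
have [sbij _ _ _] := auts; split=> [|Hx]; last by rewrite -sH; exists x.
by rewrite -{1}sH => -[y Hy /(bij_inj sbij) <-].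
Qed.

End Automorphism.

Lemma conj_core_invariant L (G : groupType) (S : expansion L G) (H : set G) :
  Defs.invariant S set0 H -> Defs.invariant S set0 (conj_core H).
Proof.
move=> Hinv s auts _; case: (auts) => -[t st ts] _ _ _.
apply/seteqP; split=> [_ [x Hx <-] g|x Hx].
  by rewrite -[g]ts -(automorphismJ auts); apply/(invariant_automorphism auts).
exists (t x); rewrite ?ts// => g.
by apply/(invariant_automorphism auts _ Hinv); rewrite (automorphismJ auts) ts.
Qed.

Section InvariantSubgroups.
Variables (L : language) (X Xs : groupType) (K : cardinal).
Variables (S : expansion L X) (Ss : expansion L Xs) (e : X -> Xs).
Hypothesis mon : monster_model K S Ss e.
Hypothesis XK : [set: set (X * nat)] #<= [set: K].

Let emb : elementary_embedding S Ss e. Proof. by case: mon. Qed.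
Let sat_Ss : saturated Ss K. Proof. by case: mon. Qed.
Let hom_Ss : strongly_homogeneous Ss K. Proof. by case: mon. Qed.

(** The two elements of [bool] serve as variables, so the formulas true under [pair_val x y] are the
    type of the pair over the empty set. *)
Definition pair_val (x y : Xs) (b : bool) := if b then x else y.

Lemma definable_pair1 (B : set Xs) c phi : B c ->
  definable Ss B [set z | sat Ss (pair_val c z) phi].
Proof.
move=> Bc; pose r (b : bool) := if b then Some tt else None.
have -> : [set z | sat Ss (pair_val c z) phi] =
    [set z | sat Ss (oapp (fun=> c) z) (frename r phi)]; last exact: definable_inst.
apply/funext => z; apply/propext; rewrite /mkset sat_frename.
by suff -> : oapp (fun=> c) z \o r = pair_val c z by []; apply/funext => -[].
Qed.

Lemma definable_pair2 (B : set Xs) c phi : B c ->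
  definable Ss B [set z | sat Ss (pair_val z c) phi].
Proof.
move=> Bc; pose r (b : bool) := if b then None else Some tt.
have -> : [set z | sat Ss (pair_val z c) phi] =
    [set z | sat Ss (oapp (fun=> c) z) (frename r phi)]; last exact: definable_inst.
apply/funext => z; apply/propext; rewrite /mkset sat_frename.
by suff -> : oapp (fun=> c) z \o r = pair_val z c by []; apply/funext => -[].
Qed.


(* [x] realizes over [B] the coheir type defined by the ultrafilter [U] on [X]. *)
Definition coheir (U : set_system X) (B : set Xs) (x : Xs) :=
  forall D, definable Ss B D -> U (e @^-1` D) -> D x.

Lemma coheirP U B x D : UltraFilter U -> coheir U B x -> definable Ss B D ->
  D x <-> U (e @^-1` D).
Proof.
move=> UU cx dD; split=> [Dx|]; last exact: cx.
have [//|UC] := in_ultra_setVsetC (e @^-1` D) UU.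
by have := cx _ (definableC dD) UC.
Qed.

Lemma coheir_sub U B C x : B `<=` C -> coheir U C x -> coheir U B x.
Proof. by move=> BC cx D dD; apply: cx; exact: definable_mono dD. Qed.

(** The sets definable over [e X] that contain [x] have nonempty traces on [X], closed under
    intersection; any ultrafilter through these traces works. *)
Lemma coheir_exists x : exists2 U, UltraFilter U & coheir U (range e) x.
Proof.
pose I := [set D | definable Ss (range e) D /\ D x].
have [|U [UU IU]] := @ultraFilterLemma _ (filter_from I (fun D => e @^-1` D)).
  apply: filter_from_proper; last first.
    by move=> D [dD Dx]; apply: (definable_emb_nonempty emb) => //; exists x.
  apply: filter_from_filter; first by exists setT; split=> //; exact: definableT.
  move=> D E [dD Dx] [dE Ex]; exists (D `&` E) => //.
  by split=> //; exact: definableI.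
exists U => // D dD UD; apply: contrapT => nDx.
have : U (e @^-1` (~` D)).
  by apply: IU; exists (~` D) => //; split=> //; exact: definableC.
by move=> /(filterI UD); rewrite -preimage_setI setICr preimage_set0; exact: filter_not_empty.
Qed.

Lemma coheir_realized U B : UltraFilter U -> small K B -> exists x, coheir U B x.
Proof.
move=> UU sB; pose F := [set D | definable Ss B D /\ U (e @^-1` D)].
have [|D [dD UD]|D E [dD UD] [dE UE]|x xF] :=
    @saturated_directed _ _ Ss K B F sat_Ss sB.
- by exists setT; split; [exact: definableT|rewrite preimage_setT; exact: filterT].
- by split=> //; have [m Dm] := filter_ex UD; exists (e m).
- by exists (D `&` E) => //; split; [exact: definableI|exact: filterI].
by exists x => D dD UD; apply: xF.
Qed.

Let small_range C : small K C -> small K (C `|` range e).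
Proof. exact: small_setU (card_range_emb e) XK. Qed.

Let small_add1 (C : set Xs) x : small K C -> small K (C `|` [set x]).
Proof.
apply: small_setU XK.
by apply: (@card_le_rel _ _ _ _ (fun _ _ => True)) => [_ _|_ _ _ -> ->//]; exists 1.
Qed.

Lemma pair_automorphism x1 x2 y1 y2 :
  (forall phi, sat Ss (pair_val x1 x2) phi <-> sat Ss (pair_val y1 y2) phi) ->
  exists s, [/\ automorphism Ss s, s x1 = y1 & s x2 = y2].
Proof.
move=> xy; pose A : set Xs := [set x1] `|` [set x2].
have sA : small K A.
  apply: small_add1; rewrite -[[set x1]]set0U; apply: small_add1.
  move=> /cardT_leP[f _ f0]; case/cardT_leP: XK => g _ _.
  exact: (f0 (g set0)).
pose f (a : A) := if val a == x1 then y1 else y2.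
pose r (a : A) := val a == x1.
have Af a : (pair_val x1 x2) (r a) = val a.
  rewrite /r; case: eqP => [->//|]; case: (set_mem (valP a)) => // -> //.
have [|s auts sf] := hom_Ss sA (f := f).
  move=> phi.
  have -> : sat Ss val phi <-> sat Ss (pair_val x1 x2) (frename r phi).
    by rewrite sat_frename; suff -> : pair_val x1 x2 \o r = val by []; apply/funext.
  by rewrite xy sat_frename.
exists s; split=> //.
  pose a : A := exist _ x1 (mem_set (or_introl erefl : A x1)).
  by have := sf a; rewrite /f /= eqxx.
pose a : A := exist _ x2 (mem_set (or_intror erefl : A x2)).
(* If [x2 = x1], then [f] sends both to [y1], and the equation between the two variables yields
   [y1 = y2]. *)
have := sf a; rewrite /f /=; case: eqP => // x21 ->.
by apply: ((xy (FEq (TVar L true) (TVar L false))).1 _); rewrite /= x21.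
Qed.

Variable H : set Xs.
Hypotheses (sgH : is_subgroup H) (Hinv : Defs.invariant Ss set0 H).
Hypothesis Hbd : bounded_index K H.

Let pair_mem x1 x2 y1 y2 :
  (forall phi, sat Ss (pair_val x1 x2) phi <-> sat Ss (pair_val y1 y2) phi) ->
  H (x1^-1 * x2) -> H (y1^-1 * y2).
Proof.
move=> /pair_automorphism[s [auts <- <-]] Hx.
case: (auts) => _ sM _ _; rewrite -(automorphismV auts) -sM.
exact/(invariant_automorphism auts).
Qed.

(* Over a transversal [C] of [H], all realizations of the coheir of [U] lie in *)
(* one coset, since an automorphism fixing the representative of one of them   *)
(* moves it to any other. As the coheir is invariant over [e X], this extends  *)
(* to all elements with the same type over [e X].                              *)
Lemma coheir_coset U x y : UltraFilter U ->
  coheir U (range e) x -> coheir U (range e) y -> H (x^-1 * y).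
Proof.
move=> UU; have [C sC CH] := bounded_index_transversal sgH Hbd.
have [z cz] := coheir_realized UU (small_range sC).
suff near_z t : coheir U (range e) t -> H (t^-1 * z).
  by move=> /near_z/(coset_sym sgH) Hx /near_z/(coset_sym sgH); exact: coset_div Hx.
move=> ct; pose B := (C `|` range e) `|` [set t] `|` [set z].
have [w cw] : exists w, coheir U B w.
  by apply: coheir_realized; do 2!apply: small_add1; exact: small_range.
have czw : H (z^-1 * w).
  have [c Cc Hcz] := CH z; apply: (coset_div sgH Hcz).
  apply: (pair_mem _ Hcz) => phi.
  have dphi : definable Ss (C `|` range e) [set v | sat Ss (pair_val c v) phi].
    by apply: definable_pair1; left.
  have := coheirP UU cz dphi; rewrite /mkset => ->; apply: iff_sym.
  by apply: (coheirP UU _ dphi); apply: coheir_sub cw => v Cv; left; left.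
(* It remains to compare [t] with [w]. Whether [phi] holds of [(v, w)] is decided by [U] and the
   type of [v] over [e X], which [z] and [t] share. *)
apply: (coset_div sgH (z := w)); last exact: coset_sym.
apply: coset_sym => //; apply: (pair_mem _ czw) => phi.
have pU v : B v -> sat Ss (pair_val v w) phi <-> U [set m | sat Ss (pair_val v (e m)) phi].
  by move=> Bv; apply: (coheirP UU cw (definable_pair1 phi Bv)).
rewrite !pU; [|by left; right|by right].
suff -> : [set m | sat Ss (pair_val z (e m)) phi] = [set m | sat Ss (pair_val t (e m)) phi] by [].
apply/funext => m; apply/propext; rewrite /mkset.
have dphi : definable Ss (range e) [set v | sat Ss (pair_val v (e m)) phi].
  by apply: definable_pair2; exists m.
have cz' : coheir U (range e) z by apply: coheir_sub cz => v; right.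
by have := coheirP UU cz' dphi; have := coheirP UU ct dphi; rewrite /mkset => -> ->.
Qed.

(** The coset of [x] is coded by how left multiplication by [x] relates ultrafilters. If [x] and [y]
    have the same code, each [g] has a [g'] such that [g], [g'] share a coheir and so do [x * g],
    [y * g']; by [coheir_coset] this puts [(x^-1 * y) ^ g] in [H]. The bound depends on [X]
    alone. *)
Lemma conj_core_card :
  range (left_coset (conj_core H)) #<= [set: set (set (set X) * set (set X))].
Proof.
pose code g U := UltraFilter U /\ coheir U (range e) g.
have codeH U g g' : code g U -> code g' U -> H (g^-1 * g').
  by move=> [UU cg] [_ cg']; exact: coheir_coset cg cg'.
pose act x := [set UV | exists g, code g UV.1 /\ code (x * g) UV.2].
apply: (@card_le_rel _ _ _ _
  (fun c P => exists x, c = left_coset (conj_core H) x /\ P = act x)).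
  by move=> _ [x _ <-]; exists (act x) => //; exists x.
move=> _ _ _ _ _ [x [-> ->]] [y [-> xy]].
apply/left_coset_eq => [|g]; first exact: conj_core_subgroup.
have [U UU cU] := coheir_exists g; have [V UV cV] := coheir_exists (x * g).
have : act x (U, V) by exists g.
rewrite xy => -[g' [/= cg' cyg']].
have gg' : H (g'^-1 * g) by apply: codeH cg' _.
have xyg : H ((x * g)^-1 * (y * g')) by apply: codeH cyg'.
have -> : (x^-1 * y) ^ g = (x * g)^-1 * (y * g') * (g'^-1 * g).
  by rewrite conjgE invgM !mulgA mulgK.
by case: sgH => _ HM _; exact: HM.
Qed.

End InvariantSubgroups.

Lemma component_infty_subgroup L (G : groupType) (S : expansion L G) K A :
  is_subgroup (component_infty S K A).
Proof.
split=> [H [[]]//|x y xH yH H /[dup] HP [[_ HM _] _ _]|x xH H /[dup] HP [[_ _ HV] _ _]].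
  by apply: HM; [exact: xH|exact: yH].
by apply: HV; exact: xH.
Qed.

Lemma component_infty_conj L (X Xs : groupType) (K : cardinal)
    (S : expansion L X) (Ss : expansion L Xs) (e : X -> Xs) x g :
  monster_model K S Ss e -> [set: set (X * nat)] #<= [set: K] ->
  [set: set (set (set (set X) * set (set X)))] #<= [set: K] ->
  component_infty Ss K set0 x -> component_infty Ss K set0 (x ^ g).
Proof.
move=> mon XK XXK xN H [sgH Hinv Hbd].
apply: (xN (conj_core H)); split.
- exact: conj_core_subgroup.
- exact: conj_core_invariant.
- by apply: small_le_type XXK; exact: (conj_core_card mon).
Qed.

(** * Free products of copies of a group *)

Section FreePower.
Variables (I : choiceType) (A : groupType).

Implicit Types (l : I * A) (w : seq (I * A)).

Definition reduced w :=
  all (fun l => l.2 != 1) w && sorted (fun l l' => l.1 != l'.1) w.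

Definition lmul l w : seq (I * A) :=
  if l.2 == 1 then w else
  if w is l' :: w' then
    if l.1 == l'.1 then
      if l.2 * l'.2 == 1 then w' else (l.1, l.2 * l'.2) :: w'
    else l :: w
  else [:: l].

Definition wmul w w' := foldr lmul w' w.

Definition linv l := (l.1, l.2^-1).

Definition winv w := rev (map linv w).

Lemma reduced_cons l w : reduced (l :: w) =
  [&& l.2 != 1, (if w is l' :: _ then l.1 != l'.1 else true) & reduced w].
Proof.
rewrite /reduced /=; case: w => [|l' w] /=; first by rewrite !andbT.
by rewrite -!andbA; case: (l.2 != 1) => //=; case: (l.1 != l'.1) => //=; rewrite !andbF.
Qed.

Lemma lmul_reduced l w : reduced (l :: w) -> lmul l w = l :: w.
Proof.
rewrite reduced_cons /lmul => /and3P[/negPf-> + _].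
by case: w => // l' w /negPf->.
Qed.

Lemma reduced_lmul l w : reduced w -> reduced (lmul l w).
Proof.
rewrite /lmul; case: eqP => // /eqP l1 rw.
case: w rw => [|l' w] rw; first by rewrite reduced_cons l1.
case: eqP => [ll'|/eqP ll']; last by rewrite reduced_cons l1 ll' rw.
move: rw; rewrite reduced_cons => /and3P[l'1 w' rw].
by case: eqP => // /eqP p1; rewrite reduced_cons /= p1 rw ll' w'.
Qed.

Lemma lmul1 i w : lmul (i, 1) w = w.
Proof. by rewrite /lmul eqxx. Qed.

(** Van der Waerden's argument: each factor acts on the reduced words, and associativity of [wmul]
    follows letter by letter. *)
Lemma lmulM i a b w : reduced w -> lmul (i, a) (lmul (i, b) w) = lmul (i, a * b) w.
Proof.
have [->|b1] := eqVneq b 1; first by rewrite lmul1 mulg1.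
have [->|a1] := eqVneq a 1; first by rewrite lmul1 mul1g.
case: w => [|[j c] w] rw; rewrite /lmul /= (negPf a1) (negPf b1) /= ?eqxx.
  by [].
have [ij|ij] := eqVneq i j; last first.
  by rewrite eqxx.
move: rw; rewrite reduced_cons /= => /and3P[c1 wc rw].
have [bc1|bc1] := eqVneq (b * c) 1.
  have ac : a * b * c = a by rewrite -mulgA bc1 mulg1.
  case: w wc rw => [|[k d] w] wc rw.
    rewrite ac (negPf a1); case: eqVneq => // ab1.
    by move: ac; rewrite ab1 mul1g => ->; rewrite ij.
  rewrite ac (negPf a1) ij (negPf wc); case: eqVneq => // ab1.
  by move: ac; rewrite ab1 mul1g => ->.
rewrite eqxx -mulgA; have [ab1|ab1] := eqVneq (a * b) 1; last by [].
by rewrite mulgA ab1 mul1g (negPf c1) ij.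
Qed.

Lemma reduced_wmul w w' : reduced w' -> reduced (wmul w w').
Proof. by move=> rw'; elim: w => //= l w; exact: reduced_lmul. Qed.

Lemma wmul_lmul l w w' : reduced w -> reduced w' ->
  wmul (lmul l w) w' = lmul l (wmul w w').
Proof.
case: l => i a rw rw'; rewrite {1}/lmul /=.
have [->|a1] := eqVneq a 1; first by rewrite lmul1.
case: w rw => [|[j b] w] rw //=.
have [->|//] := eqVneq i j.
rewrite lmulM; last exact: reduced_wmul.
by case: eqVneq => [->|//]; rewrite lmul1.
Qed.

Lemma wmulA w1 w2 w3 : reduced w2 -> reduced w3 ->
  wmul w1 (wmul w2 w3) = wmul (wmul w1 w2) w3.
Proof.
move=> r2 r3; elim: w1 => //= l w ->.
by rewrite wmul_lmul //; exact: reduced_wmul.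
Qed.

Lemma wmul_cat w w' : reduced (w ++ w') -> wmul w w' = w ++ w'.
Proof.
elim: w => //= l w IH; rewrite -cat_cons => r.
have rw : reduced (w ++ w') by move: r; rewrite reduced_cons => /and3P[].
by rewrite IH //; exact: lmul_reduced.
Qed.

Lemma wmul_nil w : reduced w -> wmul w [::] = w.
Proof. by move=> rw; rewrite wmul_cat cats0. Qed.

Lemma reduced_rev w : reduced (rev w) = reduced w.
Proof.
rewrite /reduced all_rev rev_sorted; congr (_ && _).
by apply: eq_sorted => l l'; rewrite eq_sym.
Qed.

Lemma reduced_winv w : reduced w -> reduced (winv w).
Proof.
rewrite /winv reduced_rev /reduced all_map sorted_map => /andP[w1 ws].
by apply/andP; split=> //; apply: sub_all w1 => l /=; rewrite invg_eq1.
Qed.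

Lemma winvK : involutive winv.
Proof.
move=> w; rewrite /winv map_rev revK -map_comp map_id_in // => l _.
by case: l => i a; rewrite /linv /= invgK.
Qed.

Lemma lmulK l w : reduced (l :: w) -> lmul (linv l) (l :: w) = w.
Proof.
rewrite reduced_cons /lmul /= => /andP[l1 _].
by rewrite invg_eq1 (negPf l1) eqxx mulVg eqxx.
Qed.

Lemma wmulV w : reduced w -> wmul (winv w) w = [::].
Proof.
elim: w => //= l w IH rlw; rewrite /winv /= rev_cons /wmul foldr_rcons lmulK //.
by apply: IH; move: rlw; rewrite reduced_cons => /and3P[].
Qed.

Definition free_power := {w : seq (I * A) | reduced w}.

Definition of_reduced w (rw : reduced w) : free_power := exist _ w rw.

HB.instance Definition _ := Choice.on free_power.

Definition fp_mul (x y : free_power) : free_power :=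
  of_reduced (reduced_wmul (val x) (valP y)).
Definition fp_inv (x : free_power) : free_power :=
  of_reduced (reduced_winv (valP x)).
Definition fp_one : free_power := @of_reduced [::] isT.

Lemma fp_mulA : associative fp_mul.
Proof. by move=> x y z; apply: val_inj; apply: wmulA; exact: valP. Qed.
Lemma fp_mul1 : left_id fp_one fp_mul.
Proof. by move=> x; exact: val_inj. Qed.
Lemma fp_mulr1 : right_id fp_one fp_mul.
Proof. by move=> x; apply: val_inj; apply: wmul_nil; exact: valP. Qed.
Lemma fp_mulV : left_inverse fp_one fp_inv fp_mul.
Proof. by move=> x; apply: val_inj; apply: wmulV; exact: valP. Qed.
Lemma fp_mulrV : right_inverse fp_one fp_inv fp_mul.
Proof.
move=> x; apply: val_inj; rewrite /= -{1}[val x]winvK; apply: wmulV.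
exact: reduced_winv (valP x).
Qed.

HB.instance Definition _ := isGroup.Build free_power
  fp_mulA fp_mul1 fp_mulr1 fp_mulV fp_mulrV.

Lemma reduced_letter i a : reduced (lmul (i, a) [::]).
Proof. exact: reduced_lmul. Qed.

Definition letter i a : free_power := of_reduced (reduced_letter i a).

Lemma letterM i : {morph letter i : a b / a * b}.
Proof.
move=> a b; apply: val_inj.
by rewrite /= wmul_lmul /= ?lmulM //; exact: reduced_lmul.
Qed.

Lemma letter1 i : letter i 1 = 1.
Proof. by apply: val_inj; rewrite /= lmul1. Qed.

Lemma letterV i : {morph letter i : a / a^-1}.
Proof.
by move=> a; apply: (@mulgI _ (letter i a)); rewrite -letterM !mulgV letter1.
Qed.

Lemma free_power_generated (H : set free_power) : is_subgroup H ->
  (forall i a, H (letter i a)) -> H = setT.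
Proof.
move=> [H1 HM _] HL; rewrite eqEsubset; split=> // -[w rw] _.
rewrite -[exist _ _ _]/(of_reduced rw).
elim: w rw => [|[i a] w IH] rw; first by have -> : of_reduced rw = 1 by exact: val_inj.
have rw' : reduced w by move: rw; rewrite reduced_cons => /and3P[].
have -> : of_reduced rw = letter i a * of_reduced rw'.
  by apply: val_inj; rewrite /= wmul_lmul // lmul_reduced.
by apply: HM; [exact: HL|exact: IH].
Qed.

Section Evaluation.
Variables (H : groupType) (f : I -> A -> H).
Hypothesis f1 : forall i, f i 1 = 1.
Hypothesis fV : forall i a, f i a^-1 = (f i a)^-1.

Definition weval w : H := foldr (fun l h => f l.1 l.2 * h) 1 w.

Lemma weval_cat w w' : weval (w ++ w') = weval w * weval w'.
Proof. by elim: w => /= [|l w ->]; rewrite ?mul1g ?mulgA. Qed.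

End Evaluation.

(* In a product of reduced words, letters cancel in inverse pairs until at *)
(* most one pair of letters of a same factor is merged: this is the only   *)
(* place where [weval] can fail to be multiplicative.                      *)
Lemma weval_wmul (i0 : I) w w' : reduced w -> reduced w' ->
  exists i, forall (H : groupType) (f : I -> A -> H),
    (forall i, f i 1 = 1) -> (forall i a, f i a^-1 = (f i a)^-1) ->
    {morph f i : a b / a * b} -> weval f (wmul w w') = weval f w * weval f w'.
Proof.
elim/last_ind: w w' => [|w [i a] IH] w' rwi rw'.
  (* Where no letters are merged any index will do, and [i0] is the default. *)
  by exists i0 => H f *; rewrite mul1g.
have rw : reduced w.
  rewrite -reduced_rev; move: rwi.
  by rewrite -reduced_rev rev_rcons reduced_cons => /and3P[].
case: w' rw' => [|[j b] w'] rw'.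
  by exists i0 => H f *; rewrite wmul_nil// mulg1.
have [ij|ij] := eqVneq i j; last first.
  exists i0 => H f _ _ _; rewrite wmul_cat ?weval_cat//.
  move: rwi rw'; rewrite /reduced cat_rcons all_rcons !all_cat.
  case/andP=> /andP[/= a1 w1] ws /andP[/= /andP[b1 w'1] w's].
  rewrite w1 a1 b1 w'1 /=; move: ws; case: w {IH rw w1} => [|l w] /=; rewrite ?ij //.
  by rewrite rcons_path cat_path /= => /andP[-> ->]; rewrite ij.
subst j; rewrite /wmul foldr_rcons -/wmul.
have a1 : a != 1 by move: rwi; rewrite /reduced all_rcons => /andP[/andP[]].
move: (rw'); rewrite reduced_cons /= => /and3P[b1 wb rw'2].
have -> : lmul (i, a) ((i, b) :: w') = if a * b == 1 then w' else (i, a * b) :: w'.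
  by rewrite /lmul /= (negPf a1) eqxx.
(* If the facing letters cancel, the shorter words are treated by induction; if not, their product
   is a letter, reduction stops, and [i] is the only index at which multiplicativity is used. *)
have [ab1|ab1] := eqVneq (a * b) 1.
  have [k kP] := IH w' rw rw'2; exists k => H f f1 fV fk.
  rewrite -/(wmul w w') kP // -cats1 weval_cat /= mulg1.
  have -> : b = a^-1 by apply: (@mulgI _ a); rewrite ab1 mulgV.
  by rewrite fV !mulgA mulgK.
exists i => H f f1 fV fi; rewrite -/(wmul w _) wmul_cat.
  by rewrite -cats1 !weval_cat /= mulg1 fi !mulgA.
move: rwi rw'; rewrite /reduced all_rcons !all_cat /= => /andP[/andP[_ ->] ws].
case/andP=> /andP[_ ->]; rewrite ab1 /=; move: ws.
case: w {IH rw} => [|l w] /=; first by case: w' {wb rw'2}.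
by rewrite rcons_path cat_path /= => /andP[-> ->]; case: w' {wb rw'2}.
Qed.

End FreePower.

(** * The group SL2 of a field *)

Section SL2.
Variable F : fieldType.
Import GRing.Theory.

Local Open Scope ring_scope.

(* [(a, b, c, d)] stands for the matrix [[a, b], [c, d]]. *)
Definition mat2_det (m : F * F * F * F) := let: (a, b, c, d) := m in a * d - b * c.

Definition sl2 := {m : F * F * F * F | mat2_det m == 1}.

HB.instance Definition _ := Choice.on sl2.

Definition of_det1 m (h : mat2_det m == 1) : sl2 := exist _ m h.

Definition mat2_mul (m n : F * F * F * F) :=
  let: (a, b, c, d) := m in let: (a', b', c', d') := n in
  (a * a' + b * c', a * b' + b * d', c * a' + d * c', c * b' + d * d').

Definition mat2_adj (m : F * F * F * F) := let: (a, b, c, d) := m in (d, - b, - c, a).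

Lemma mat2_det_mul m n : mat2_det (mat2_mul m n) = mat2_det m * mat2_det n.
Proof. by case: m n => [[[a b] c] d] [[[a' b'] c'] d'] /=; ring. Qed.

Lemma mat2_det_adj m : mat2_det (mat2_adj m) = mat2_det m.
Proof. by case: m => [[[a b] c] d] /=; ring. Qed.

Lemma sl2_mul_subproof (x y : sl2) : mat2_det (mat2_mul (val x) (val y)) == 1.
Proof. by rewrite mat2_det_mul (eqP (valP x)) (eqP (valP y)) mulr1. Qed.

Lemma sl2_inv_subproof (x : sl2) : mat2_det (mat2_adj (val x)) == 1.
Proof. by rewrite mat2_det_adj (eqP (valP x)). Qed.

Lemma sl2_one_subproof : mat2_det (1, 0, 0, 1) == 1.
Proof. by apply/eqP => /=; ring. Qed.

Definition sl2_mul (x y : sl2) : sl2 := of_det1 (sl2_mul_subproof x y).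
Definition sl2_inv (x : sl2) : sl2 := of_det1 (sl2_inv_subproof x).
Definition sl2_one : sl2 := of_det1 sl2_one_subproof.

Lemma sl2_mulA : associative sl2_mul.
Proof.
move=> [[[[a b] c] d] ?] [[[[a' b'] c'] d'] ?] [[[[a1 b1] c1] d1] ?].
by apply: val_inj => /=; congr (_, _, _, _); ring.
Qed.

Lemma sl2_mul1 : left_id sl2_one sl2_mul.
Proof.
by move=> [[[[a b] c] d] ?]; apply: val_inj => /=; congr (_, _, _, _); ring.
Qed.

Lemma sl2_mulr1 : right_id sl2_one sl2_mul.
Proof.
by move=> [[[[a b] c] d] ?]; apply: val_inj => /=; congr (_, _, _, _); ring.
Qed.

Lemma sl2_mulV : left_inverse sl2_one sl2_inv sl2_mul.
Proof.
move=> [[[[a b] c] d] h]; apply: val_inj => /=; move: h => /= /eqP h.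
by congr (_, _, _, _); rewrite -?h; ring.
Qed.

Lemma sl2_mulrV : right_inverse sl2_one sl2_inv sl2_mul.
Proof.
move=> [[[[a b] c] d] h]; apply: val_inj => /=; move: h => /= /eqP h.
by congr (_, _, _, _); rewrite -?h; ring.
Qed.

HB.instance Definition _ := isGroup.Build sl2
  sl2_mulA sl2_mul1 sl2_mulr1 sl2_mulV sl2_mulrV.

Lemma upper_subproof b : mat2_det (1, b, 0, 1) == 1.
Proof. by apply/eqP => /=; ring. Qed.
Definition upper b : sl2 := of_det1 (upper_subproof b).

Lemma lower_subproof c : mat2_det (1, 0, c, 1) == 1.
Proof. by apply/eqP => /=; ring. Qed.
Definition lower c : sl2 := of_det1 (lower_subproof c).

(** A matrix with nonzero lower left entry is an explicit product upper, lower, upper. If that entry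
    is zero, multiplying by [lower 1] replaces it by the upper left one, nonzero by the
    determinant. *)
Lemma sl2_generated (H : set sl2) : is_subgroup H ->
  (forall b, H (upper b)) -> (forall c, H (lower c)) -> H = setT.
Proof.
move=> [H1 HM HV] HU HL; rewrite eqEsubset; split=> // x _.
have gen (y : sl2) : (val y).1.2 != 0 -> H y.
  case: y => [[[[a b] c] d] h] /= c0.
  rewrite -[exist _ _ _]/(of_det1 h).
  have -> : of_det1 h =
      (upper ((a - 1) / c) * lower c * upper ((d - 1) / c))%g.
    apply: val_inj => /=; move: h => /= /eqP h.
    have -> : b = (a * d - 1) / c by rewrite -h; field.
    by congr (_, _, _, _); field.
  by apply: (HM); first apply: HM.
have [c0|] := eqVneq (val x).1.2 0; last exact: gen.
rewrite -[x](mulKg (lower 1)); apply: HM; first exact: HV.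
apply: gen; case: x c0 => [[[[a b] c] d] h] /= c0; move: h => /= /eqP h.
rewrite c0 mul1r mulr0 addr0; apply: contra_eq_neq h => ->.
by rewrite c0 mul0r mulr0 subr0 eq_sym oner_eq0.
Qed.

Lemma diag_subproof (r : F) (r0 : r != 0) : mat2_det (r, 0, 0, r^-1) == 1.
Proof. by apply/eqP => /=; field. Qed.
Definition diag r (r0 : r != 0) : sl2 := of_det1 (diag_subproof r0).

(** For [w = upper t] the right-hand side is [upper (t * (r ^- 2 - 1))]; the witness solves this for
    [t]. *)
Lemma upper_commutator b (z : sl2) r : val z = (r, 0, 0, r^-1) -> r != 0 ->
  r ^+ 2 != 1 -> exists w, upper b = ((z ^ w)^-1 * z)%g.
Proof.
move=> zr r0 r2; have r21 : 1 - r ^+ 2 != 0 by rewrite subr_eq0 eq_sym.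
exists (upper (b * r ^+ 2 / (1 - r ^+ 2))).
apply: val_inj; rewrite /= zr /=.
by congr (_, _, _, _); field; rewrite ?r0 ?r21.
Qed.

Lemma lower_commutator c (z : sl2) r : val z = (r, 0, 0, r^-1) -> r != 0 ->
  r ^+ 2 != 1 -> exists w, lower c = ((z ^ w)^-1 * z)%g.
Proof.
move=> zr r0 r2; have r21 : r ^+ 2 - 1 != 0 by rewrite subr_eq0.
exists (lower (c / (r ^+ 2 - 1))).
apply: val_inj; rewrite /= zr /=.
by congr (_, _, _, _); field; rewrite ?r0 ?r21.
Qed.

Lemma diag_div r s (r0 : r != 0) (s0 : s != 0) :
  val ((diag r0)^-1 * diag s0)%g = (s / r, 0, 0, (s / r)^-1).
Proof. by rewrite /=; congr (_, _, _, _); field; rewrite ?r0 ?s0. Qed.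

End SL2.

(** * Rational unipotents as infinitely repeated commutators *)

Section SL2rat.
Import Order.TTheory GRing.Theory Num.Theory.
Local Open Scope ring_scope.

Let expn2_neq0 n : (2 ^+ n : rat) != 0. Proof. by rewrite expf_neq0. Qed.

Let div_expn2 i j : i != j -> ((2 ^+ j / 2 ^+ i : rat) ^+ 2 != 1).
Proof.
move=> ij; rewrite expr_div_n -!exprM; apply: contra ij => /eqP h.
move: h => /divr1_eq.
by move=> /ieexprIn/=> /(_ isT isT)/eqP; rewrite eqn_mul2r /= eq_sym => ->.
Qed.

(** The diagonal matrices of the powers of 2 have pairwise quotients with entry of square distinct
    from 1, as the commutator lemmas demand. *)
Lemma sl2_infinitely_commutator (z : sl2 rat) :
  (exists b, z = upper b) \/ (exists c, z = lower c) ->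
  exists Y : nat -> sl2 rat, forall i j, i != j ->
    exists w, z = ((((Y i)^-1 * Y j) ^ w)^-1 * ((Y i)^-1 * Y j))%g.
Proof.
move=> zP; exists (fun n => diag (expn2_neq0 n)) => i j ij.
have r0 : (2 ^+ j / 2 ^+ i : rat) != 0 by rewrite mulf_neq0 ?invr_neq0 ?expf_neq0.
by case: zP => -[b ->]; [apply: upper_commutator (diag_div _ _) r0 (div_expn2 ij)
  |apply: lower_commutator (diag_div _ _) r0 (div_expn2 ij)].
Qed.

End SL2rat.

Lemma infinitely_commutator_morph (G H : groupType) (f : G -> H) z :
  {morph f : x y / x * y} -> {morph f : x / x^-1} ->
  infinitely_commutator z -> infinitely_commutator (f z).
Proof.
move=> fM fV [Y zY]; exists (f \o Y) => i j /zY[w ->]; exists (f w) => /=.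
by rewrite !conjgE !(fM, fV).
Qed.

Theorem free_power_sl2_type_absolutely_connected (I : choiceType) :
  type_absolutely_connected (free_power I (sl2 rat)).
Proof.
apply: type_absolutely_connected_criterion => H sgH cH.
apply: free_power_generated => // i.
have lH z : infinitely_commutator z -> H (letter i z).
  move=> zc; apply: cH; apply: infinitely_commutator_morph zc.
    exact: letterM.
  exact: letterV.
have : letter i @^-1` H = setT.
  apply: sl2_generated => [|b|c]; last 2 first.
  - by apply/lH/sl2_infinitely_commutator; left; exists b.
  - by apply/lH/sl2_infinitely_commutator; right; exists c.
  case: sgH => H1 HM HV; split=> [|x y|x] /=.
  - by rewrite letter1.
  - by rewrite letterM; exact: HM.
  - by rewrite letterV; exact: HV.
by move=> h a; rewrite -[H _]/((letter i @^-1` H) a) h.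
Qed.

(** * Quotient groups *)

Section QuotientClass.
Variables (G : groupType) (N H : set G) (nNH : is_normal_in N H).

Definition coset_class x (Hx : H x) : quotient_group nNH :=
  exist _ (left_coset N x) (ex_intro2 _ _ x Hx erefl).

Lemma quotient_eq (C D : quotient_group nNH) : sval C = sval D -> C = D.
Proof. by case: C D => [C pC] [D pD] /= CD; exact: eq_exist. Qed.

Lemma coset_class_surj (C : quotient_group nNH) :
  exists x (Hx : H x), C = coset_class Hx.
Proof. by case: (proj2_sig C) => x Hx Cx; exists x, Hx; exact: quotient_eq. Qed.

Lemma coset_classM x y (Hx : H x) (Hy : H y) (Hxy : H (x * y)) :
  coset_class Hxy = coset_class Hx * coset_class Hy.
Proof. by apply: quotient_eq; rewrite /= -(mul_left_coset nNH). Qed.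

Lemma coset_class_eq x y (Hx : H x) (Hy : H y) :
  coset_class Hx = coset_class Hy <-> N (x^-1 * y).
Proof.
have sgN : is_subgroup N by case: nNH.
rewrite -(left_coset_eq x y sgN); split=> [/(congr1 (@sval _ _))//|xy].
exact: quotient_eq.
Qed.

End QuotientClass.

Lemma homomorphic_image_abelian (G H : groupType) :
  homomorphic_image_of H G -> abelian_group G -> abelian_group H.
Proof.
move=> [f frange] Gab x y.
have [[a _ <-] [b _ <-]] : range f x /\ range f y by rewrite frange.
by rewrite /commute -!gmulfM Gab.
Qed.

(** Two sequences that fail to commute at every nonabelian index have products differing at
    infinitely many places. *)
Lemma product_mod_sum_nonabelian (G : nat -> groupType) :
  infinite_set [set n | ~ abelian_group (G n)] ->
  ~ abelian_group (quotient_group (direct_sum_normal G)).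
Proof.
move=> Ginf Gab; apply: Ginf.
have xyP n : exists p : G n * G n, ~ abelian_group (G n) -> p.1 * p.2 <> p.2 * p.1.
  have [ab|/existsNP[x /existsNP[y xy]]] := pselect (abelian_group (G n)).
    by exists (1, 1).
  by exists (x, y).
pose p n := sval (cid (xyP n)); have pP n := svalP (cid (xyP n)).
pose x : product_group G := fun n => (p n).1.
pose y : product_group G := fun n => (p n).2.
pose cls (z : product_group G) : quotient_group (direct_sum_normal G) :=
  coset_class (direct_sum_normal G) (I : [set: product_group G] z).
have clsM u v : cls (u * v) = cls u * cls v by exact: coset_classM.
have : cls (x * y) = cls (y * x) by rewrite !clsM; exact: Gab.
rewrite /cls coset_class_eq; apply: sub_finite_set => n /= nab xy; apply: (pP n nab).
have {}xy : (x n * y n)^-1 * (y n * x n) = 1 by exact: xy.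
by apply: (@mulgI _ (x n * y n)^-1); rewrite mulVg xy.
Qed.

(** * Standard parts of almost homomorphisms *)

Definition preimage_language (G : nat -> Type) : language :=
  @Language void (fun=> 0%N) {n & set (G n)} (fun=> 1%N).

Definition preimage_expansion (G : nat -> Type) (X : groupType)
    (f : forall n, X -> G n) : expansion (preimage_language G) X :=
  @Expansion (preimage_language G) X (fun _ _ => 1)
    (fun r xs => projT2 r (f (projT1 r) (xs ord0))).

Section StandardPart.
Variable G : nat -> topologicalGroupType.
Hypothesis G_compact : forall n, compact [set: G n].
Hypothesis G_hausdorff : forall n, hausdorff_space (G n).
Variables (X : groupType) (f : forall n, X -> G n).
Hypothesis f_almost_morph :
  forall x y, exists m : nat, forall n : nat, n != m -> f n (x * y) = f n x * f n y.
Hypothesis f_interp :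
  forall (g : forall n, G n) N, exists x, forall n, (n < N)%N -> f n x = g n.

Let L := preimage_language G.
Let S : expansion L X := preimage_expansion f.

Variables (K : cardinal) (Xs : groupType) (Ss : expansion L Xs) (e : X -> Xs).
Hypothesis mon : monster_model K S Ss e.
Hypothesis XK : [set: set (X * nat)] #<= [set: K].
Hypothesis GK : [set: set (product_group G)] #<= [set: K].

Let emb : elementary_embedding S Ss e. Proof. by case: mon. Qed.

Let FR V n (C : set (G n)) (t : term L V) : formula L V :=
  @FRel L V (existT _ n C) (fun=> t).

(** For fixed [n] and [x], the sets [C] satisfying this form an ultrafilter on [G n]: each axiom is
    a sentence true in [X]. *)
Definition rel_star n (C : set (G n)) (x : Xs) : Prop :=
  @rel_interp L Xs Ss (existT _ n C) (fun=> x).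

Lemma rel_starS n (C D : set (G n)) x : C `<=` D -> rel_star C x -> rel_star D x.
Proof.
move=> CD; apply: ((emb (FAll (FImp (FR C (TVar L None)) (FR D (TVar L None))))).1 _ x).
by move=> y /=; exact: CD.
Qed.

Lemma rel_starI n (C D : set (G n)) x :
  rel_star C x -> rel_star D x -> rel_star (C `&` D) x.
Proof.
apply: ((emb (FAll (FImp (FR C (TVar L None)) (FImp (FR D (TVar L None))
  (FR (C `&` D) (TVar L None)))))).1 _ x).
by move=> y /=.
Qed.

Lemma rel_star0 n x : ~ rel_star (@set0 (G n)) x.
Proof.
apply: ((emb (FAll (FImp (FR (@set0 (G n)) (TVar L None)) (FFalse _ _)))).1 _ x).
by move=> y /=.
Qed.

Lemma rel_starT n x : rel_star [set: G n] x.
Proof. by apply: ((emb (FAll (FR setT (TVar L None)))).1 _ x) => y /=. Qed.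

Lemma rel_starVC n (C : set (G n)) x : rel_star C x \/ rel_star (~` C) x.
Proof.
have [//|nC] := pselect (rel_star C x); [by left|right].
apply: ((emb (FAll (FImp (FNot (FR C (TVar L None))) (FR (~` C) (TVar L None))))).1 _ x) nC.
by move=> y /=.
Qed.

(** Compactness gives the ultrafilter a cluster point, which for an ultrafilter is a limit. *)
Lemma standard_part_exists n x :
  exists g : G n, forall C, nbhs g C -> rel_star C x.
Proof.
pose F : set_system (G n) := [set C | rel_star C x].
have FF : ProperFilter F.
  apply: Build_ProperFilter; first exact: rel_star0.
  split; first exact: rel_starT.
    by move=> C D; exact: rel_starI.
  by move=> C D; exact: rel_starS.
have [g [_ gF]] := @G_compact n F FF (rel_starT n x).
exists g => C gC; have [//|nC] := rel_starVC C x.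
by have [y []] := gF _ _ nC gC.
Qed.

Definition standard_part : Xs -> product_group G :=
  fun x n => sval (cid (standard_part_exists n x)).

Lemma standard_partP x n C : nbhs (standard_part x n) C -> rel_star C x.
Proof. by rewrite /standard_part; case: cid => g /= ; exact. Qed.

Lemma standard_part_unique x n g :
  (forall C, nbhs g C -> rel_star C x) -> standard_part x n = g.
Proof.
move=> gx; apply: G_hausdorff => C D /standard_partP Cx /gx Dx.
have /rel_starI/(_ Dx) CDx := Cx.
apply: contrapT => /set0P/negP; rewrite negbK => /eqP CD0.
by apply: (@rel_star0 n x); rewrite -CD0.
Qed.

Lemma hausdorff_mul_separation n (p q r : G n) : p <> q * r ->
  exists C D E, [/\ nbhs p C, nbhs q D, nbhs r E &
    forall c d d', C c -> D d -> E d' -> c <> d * d'].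
Proof.
move=> pqr; apply: contrapT => nsep; apply: pqr; apply: G_hausdorff => C B pC qrB.
have [[D E] [/= qD rE] DEB] := @mulg_continuous (G n) (q, r) B qrB.
apply: contrapT => CB0; apply: nsep; exists C, D, E; split=> // c d d' Cc Dd Ed' cdd'.
by apply: CB0; exists c; split=> //; rewrite cdd'; exact: (DEB (d, d')).
Qed.

(** If both indices failed, neighbourhoods would separate the products at [n] and at [m]. Only
    finitely many predicates are involved, so some pair in [X] would fail at both indices. *)
Lemma standard_part_morph2 x y n m : n != m ->
  standard_part (x * y) n = standard_part x n * standard_part y n \/
  standard_part (x * y) m = standard_part x m * standard_part y m.
Proof.
move=> nm; apply: contrapT => /not_orP[].
move=> /hausdorff_mul_separation[C [D [E [xyC xD yE sepn]]]].
move=> /hausdorff_mul_separation[C' [D' [E' [xyC' xD' yE' sepm]]]].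
pose vx V : term L (option (option V)) := TVar L (Some None).
pose vy V : term L (option (option V)) := TVar L None.
apply: ((emb (FAll (FAll (FImp (FR C (TMul (vx X) (vy X)))
  (FImp (FR D (vx X)) (FImp (FR E (vy X)) (FImp (FR C' (TMul (vx X) (vy X)))
  (FImp (FR D' (vx X)) (FImp (FR E' (vy X)) (FFalse _ _)))))))))).1 _ x y);
  [|exact: standard_partP..].
move=> {x y xyC xD yE xyC' xD' yE'} x y /= Cxy Dx Ey C'xy D'x E'y.
have [k kP] := f_almost_morph x y.
have [nk|nk] := eqVneq n k; last by apply: (sepn _ _ _ Cxy Dx Ey); exact: kP.
by apply: (sepm _ _ _ C'xy D'x E'y); apply: kP; rewrite -nk eq_sym.
Qed.

Lemma standard_part_morph x y :
  direct_sum ((standard_part x * standard_part y)^-1 * standard_part (x * y)).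
Proof.
pose bad n := standard_part (x * y) n <> standard_part x n * standard_part y n.
suff : finite_set bad.
  apply: sub_finite_set => n /=; apply: contra_not => good.
  rewrite -[LHS]/((standard_part x n * standard_part y n)^-1 * standard_part (x * y) n).
  by rewrite good mulVg.
have [[m bm]|nb] := pselect (exists m, bad m); last first.
  by apply: (@sub_finite_set _ _ set0) => // n bn; case: nb; exists n.
apply: (@sub_finite_set _ _ [set m]); last exact: finite_set1.
by move=> n bn; apply: contrapT => /eqP /(standard_part_morph2 x y)[].
Qed.

(** Each condition restricts finitely many coordinates, so [f_interp] satisfies it in [X];
    saturation satisfies all of them at once. *)
Lemma standard_part_surj (g : product_group G) : exists x, standard_part x = g.
Proof.
have [_ sat_Ss _] := mon.
have s0 : small K (@set0 Xs).
  move=> /cardT_leP[h _ h0]; case/cardT_leP: XK => k _ _; exact: (h0 (k set0)).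
pose F := [set D | exists N, exists2 C : forall n, set (G n),
  (forall n, nbhs (g n) (C n)) & D = [set x | forall n, (n < N)%N -> rel_star (C n) x]].
have [|_ [N [C gC ->]]|_ _ [N [C gC ->]] [M [D gD ->]]|x xF] :=
    @saturated_directed _ _ Ss K set0 F sat_Ss s0.
- exists setT, 0%N, (fun=> setT); first by move=> n; exact: filterT.
  by apply/seteqP; split.
- split.
    elim: N => [|N IH].
      suff -> : [set x | forall n, (n < 0)%N -> rel_star (C n) x] = setT by exact: definableT.
      by apply/seteqP; split.
    suff -> : [set x | forall n, (n < N.+1)%N -> rel_star (C n) x] =
        [set x | forall n, (n < N)%N -> rel_star (C n) x] `&` rel_star (C N).
      by apply: definableI => //; exists (FR (C N) (TVar L None)).
    apply/seteqP; split=> x.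
      by move=> h; split=> [n nN|]; apply: h => //; exact: ltnW.
    by move=> [h hN] n; rewrite ltnS leq_eqVlt => /orP[/eqP->//|]; exact: h.
  have [x xg] := f_interp g N; exists (e x) => n nN.
  apply: ((emb (FR (C n) (TVar L x))).1 _) => /=.
  by rewrite (xg n nN); exact: (nbhs_singleton (gC n)).
- exists [set x | forall n, (n < maxn N M)%N -> rel_star (C n `&` D n) x].
    exists (maxn N M), (fun n => C n `&` D n) => // n.
    by apply: filterI.
  move=> x h; split=> n nN.
    by apply: (rel_starS _ (h n _)); [move=> y []|rewrite leq_max nN].
  by apply: (rel_starS _ (h n _)); [move=> y []|rewrite leq_max nN orbT].
exists x; apply: functional_extensionality_dep => n; apply: standard_part_unique => C gC.
(* The condition on coordinate [n] alone, in the form of a family. *)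
pose C' : forall k, set (G k) := @eqtype.dfwith nat (fun k => set (G k)) (fun k => [set: G k]) n C.
have gC' k : nbhs (g k) (C' k) by rewrite /C'; case: eqtype.dfwithP => // *; exact: filterT.
have : rel_star (C' n) x.
  apply: (xF [set y | forall k, (k < n.+1)%N -> rel_star (C' k) y] _ n (ltnSn n)).
  by exists n.+1, C'.
by rewrite /C' dfwith_in.
Qed.

Let P := quotient_group (direct_sum_normal G).

Definition standard_class (x : Xs) : P :=
  coset_class (direct_sum_normal G) (I : [set: product_group G] (standard_part x)).

Lemma standard_classM : {morph standard_class : x y / x * y}.
Proof.
move=> x y; rewrite -(coset_classM _ _ _ (I : setT (standard_part x * standard_part y))).
apply/esym/coset_class_eq.
exact: standard_part_morph.
Qed.

Lemma standard_class_surj (c : P) : exists x, standard_class x = c.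
Proof.
have [g [gT ->]] := coset_class_surj (nNH := direct_sum_normal G) c; have [x xg] := standard_part_surj g.
by exists x; apply: quotient_eq; rewrite /= xg.
Qed.

Let ker := [set x | standard_class x = 1].

Let standard_class1 : standard_class 1 = 1.
Proof. by apply: (@mulgI _ (standard_class 1)); rewrite -standard_classM !mulg1. Qed.

Let standard_class_eq x y : standard_class x = standard_class y <-> ker (x^-1 * y).
Proof.
rewrite /ker /= standard_classM; have -> : standard_class x^-1 = (standard_class x)^-1.
  by apply: (@mulgI _ (standard_class x)); rewrite -standard_classM !mulgV.
split=> [->|xy]; first by rewrite mulVg.
by apply: (@mulgI _ (standard_class x)^-1); rewrite mulVg xy.
Qed.

Let ker_subgroup : is_subgroup ker.
Proof.
split=> [|x y|x]; rewrite /ker /=; first exact: standard_class1.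
  by move=> kx ky; rewrite standard_classM kx ky mulg1.
by move=> kx; rewrite -[x^-1]mulg1; apply/standard_class_eq; rewrite kx standard_class1.
Qed.

(** Automorphisms preserve the predicates, hence the standard parts. *)
Let ker_invariant : Defs.invariant Ss set0 ker.
Proof.
move=> s auts _; case: (auts) => -[t st ts] _ _ srel.
have sE x : standard_class (s x) = standard_class x.
  apply: quotient_eq => /=; congr left_coset.
  apply: functional_extensionality_dep => n; apply: standard_part_unique => C.
  by move=> /standard_partP Cx; exact/(srel (existT _ n C) (fun=> x)).
apply/seteqP; split=> [_ [x kx <-]|x kx]; first by rewrite /ker /= sE.
by exists (t x); rewrite ?ts// /ker /= -sE ts.
Qed.

(** The standard part of [x] determines its coset. *)
Let ker_bounded : bounded_index K ker.
Proof.
apply: small_le_type GK.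
apply: (@card_le_rel _ _ _ _
  (fun c g => exists x, c = left_coset ker x /\ g = standard_part x)).
  by move=> _ [x _ <-]; exists (standard_part x) => //; exists x.
move=> _ _ _ _ _ [x [-> ->]] [y [-> xy]].
apply/left_coset_eq => //; apply/standard_class_eq.
by apply: quotient_eq; rewrite /= xy.
Qed.

Lemma component_infty_standard_class x y :
  component_infty Ss K set0 (x^-1 * y) -> standard_class x = standard_class y.
Proof. by move=> h; apply/standard_class_eq; exact: h. Qed.

(** The infinity component lies in the kernel of [standard_class], so evaluating at a chosen
    representative of each coset is well behaved. *)
Lemma standard_class_homomorphic_image
    (nXs : is_normal_in (component_infty Ss K set0) (component00 Ss K set0)) :
  component00 Ss K set0 = setT ->
  homomorphic_image_of P (quotient_group nXs).
Proof.
move=> full.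
have repP (C : quotient_group nXs) : exists x, exists Hx : component00 Ss K set0 x,
    C = coset_class nXs Hx by exact: coset_class_surj.
have [rep {}repP] := choice repP.
have hE x (Hx : component00 Ss K set0 x) :
    standard_class (rep (coset_class nXs Hx)) = standard_class x.
  have [Hy /coset_class_eq xy] := repP (coset_class nXs Hx).
  by apply/esym/component_infty_standard_class.
have hM : {morph standard_class \o rep : C D / C * D}.
  move=> C D; have [x [Hx ->]] := coset_class_surj (nNH := nXs) C.
  have [y [Hy ->]] := coset_class_surj (nNH := nXs) D.
  have Hxy : component00 Ss K set0 (x * y) by rewrite full.
  by rewrite -(coset_classM nXs Hx Hy Hxy) /= !hE standard_classM.
pose m := isMultiplicative.Build (quotient_group nXs) P (standard_class \o rep) hM.
exists (HB.pack_for {multiplicative quotient_group nXs -> P} (standard_class \o rep) m).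
rewrite eqEsubset; split=> // c _; have [x <-] := standard_class_surj c.
have Hx : component00 Ss K set0 x by rewrite full.
by exists (coset_class nXs Hx) => //; exact: hE.
Qed.

End StandardPart.

(** * The almost homomorphisms *)

Section LetterMaps.
Variable G : nat -> groupType.

Let I : choiceType := {n : nat & G n}.
Let idx n (g : G n) : I := existT _ n g.
Let X := free_power I (sl2 rat).
Let a0 : sl2 rat := upper 1%R.

Let a0_neq1 : a0 != 1. Proof. by []. Qed.
Let a0V : a0 != a0^-1. Proof. by []. Qed.

(** Compatible with 1 and inverses but not multiplicative in [a], so no homomorphism from SL2 to
    [G n] is involved. *)
Definition letter_map n (i : I) (a : sl2 rat) : G n :=
  untag 1 (fun g : G n => if a == a0 then g else if a == a0^-1 then g^-1 else 1) i.

Lemma letter_map1 n i : letter_map n i 1 = 1.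
Proof. by rewrite /letter_map /untag; case: eqP. Qed.

Lemma letter_mapV n i a : letter_map n i a^-1 = (letter_map n i a)^-1.
Proof.
rewrite /letter_map /untag; case: eqP => [p|_]; last by rewrite invg1.
have -> : (a^-1 == a0) = (a == a0^-1) by rewrite -(inj_eq invg_inj) invgK.
rewrite (inj_eq invg_inj).
have [->|_] := eqVneq a a0; first by rewrite (negPf a0V).
by case: ifP => _; rewrite ?invgK ?invg1.
Qed.

Lemma letter_map_id n (g : G n) : letter_map n (idx g) a0 = g.
Proof.
rewrite /letter_map /untag; case: eqP => [p|//].
by rewrite eqxx /etagged (eq_axiomK p).
Qed.

Definition word_map n (x : X) : G n := weval (letter_map n) (val x).

(** The merging index of [weval_wmul] is the same for all targets; if its tag is not [n], then
    [letter_map n] is trivial there, hence multiplicative. *)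
Lemma word_map_almost_morph x y :
  exists m : nat, forall n : nat, n != m -> word_map n (x * y) = word_map n x * word_map n y.
Proof.
have [i iP] := weval_wmul (idx (1 : G 0%N)) (valP x) (valP y).
exists (tag i) => n ni; apply: iP => [||a b].
- exact: letter_map1.
- exact: letter_mapV.
by rewrite /letter_map !untag_dflt ?mulg1 // eq_sym.
Qed.

(** The witness is the word of the letters [a0] in the copies [(n, g n)] with [n < N]: distinct
    copies keep it reduced, and [word_map n] sees only its own letter. *)
Lemma word_map_interp (g : forall n, G n) N :
  exists x, forall n, (n < N)%N -> word_map n x = g n.
Proof.
pose w k l : seq (I * sl2 rat) := [seq (idx (g n), a0) | n <- iota k l].
have rw : reduced (w 0%N N).
  apply/andP; split; first by rewrite all_map; apply/allP => n _; exact: a0_neq1.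
  rewrite sorted_map; apply: sub_sorted (iota_ltn_sorted 0 N) => n m nm /=.
  by apply/eqP => /(congr1 tag) /= nm'; move: nm; rewrite /= nm' ltnn.
exists (of_reduced rw) => n nN; rewrite /word_map /=.
have wE k l : weval (letter_map n) (w k l) = if (k <= n < k + l)%N then g n else 1.
  elim: l k => [|l IH] k /=; first by rewrite addn0 leqNgt andNb.
  rewrite IH; have [kn|kn] := eqVneq k n.
    subst k; rewrite letter_map_id ltnn leqnn.
    by rewrite addnS ltnS leq_addr mulg1.
  rewrite /letter_map untag_dflt //= mul1g addSnnS.
  by rewrite [(k <= n)%N]leq_eqVlt (negPf kn).
by rewrite wE nN.
Qed.

End LetterMaps.

Theorem theorem4p11 (G : nat -> topologicalGroupType)
  (G_compact : forall n, compact [set: G n])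
  (G_connected : forall n, connected [set: G n])
  (G_hausdorff : forall n, hausdorff_space (G n))
  (G_weight : forall n, weight_le (G n) [set: set nat]) :
  exists (X : groupType) (L : language) (S : expansion L X),
    type_absolutely_connected X /\
    for_sufficiently_big (fun K =>
      forall (Xs : groupType) (Ss : expansion L Xs) (e : X -> Xs),
        monster_model K S Ss e ->
        exists nXs : is_normal_in (component_infty Ss K set0)
                                  (component00 Ss K set0),
          homomorphic_image_of (quotient_group (direct_sum_normal G))
                               (quotient_group nXs) /\
          (infinite_set [set n | ~ abelian_group (G n)] ->
             ~ abelian_group (quotient_group nXs))).
Proof.
pose X := free_power {n : nat & G n} (sl2 rat); pose f := @word_map (fun n => G n).
exists X, (preimage_language G), (preimage_expansion f).
have Xconn : type_absolutely_connected X.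
  exact: free_power_sl2_type_absolutely_connected.
split=> //; have [K0 K0P] := Xconn _ (preimage_expansion f).
(* The summands serve, in turn, connectedness, adding [e X] to small sets, the index of normal
   cores, and the index of the kernel. *)
exists (K0 + set (X * nat) + set (set (set (set X) * set (set X))) +
        set (product_group G))%type => K KK Xs Ss e mon.
have inl_le (T U : Type) : [set: T + U] #<= [set: K] -> [set: T] #<= [set: K].
  by apply: card_le_trans; apply: (@cardT_le _ _ inl) => x y [].
have inr_le (T U : Type) : [set: T + U] #<= [set: K] -> [set: U] #<= [set: K].
  by apply: card_le_trans; apply: (@cardT_le _ _ inr) => x y [].
have GK := inr_le _ _ KK; have {}KK := inl_le _ _ KK.
have XXK := inr_le _ _ KK; have {}KK := inl_le _ _ KK.
have XK := inr_le _ _ KK; have {inl_le inr_le}KK := inl_le _ _ KK.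
(* Fewer parameters define fewer subgroups, so this component contains the one over [e X]. *)
have full : component00 Ss K set0 = setT.
  rewrite eqEsubset; split=> // x _ H [sgH Hdef Hbd].
  have : component00 Ss K (range e) x by rewrite (K0P K KK Xs Ss e mon).
  by apply; split=> //; exact: type_definable_mono Hdef.
have nXs : is_normal_in (component_infty Ss K set0) (component00 Ss K set0).
  rewrite full; split=> //; first exact: component_infty_subgroup.
  by move=> g x _; exact: (component_infty_conj _ mon XK XXK).
exists nXs.
have him := standard_class_homomorphic_image G_compact G_hausdorff
  (@word_map_almost_morph G) (@word_map_interp G) mon XK GK nXs full.
split=> // /product_mod_sum_nonabelian nab /(homomorphic_image_abelian him).
exact: nab.
Qed.
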